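(* Let $k,l\geqslant 2$ be integers with $k+l\leqslant 8$, let $M=S^{k+l+1}$ or $M=S^{k+1}\times S^l$, and let $(g_i)_{i\in\mathbb N}$ be a sequence of Böhm metrics on $M$, $g_i=dt^2+f_i(t)^2g^k+h_i(t)^2g^l$. Let $$f_c(t)=\sqrt{\tfrac{k-1}{k+l-1}}\,\sin t,\qquad h_c(t)=\sqrt{\tfrac{l-1}{k+l-1}}\,\sin t,\qquad t\in[0,\pi].$$ Then for every compact subset $K$ of $(0,\pi)$ and every $n\in\mathbb N$, $$\left\|f_i^{(n)}-f_c^{(n)}\right\|_{\infty,K}\underset{i\to+\infty}{\longrightarrow}0\quad\text{and}\quad\left\|h_i^{(n)}-h_c^{(n)}\right\|_{\infty,K}\underset{i\to+\infty}{\longrightarrow}0,$$ where $\|\cdot\|_{\infty,K}$ is the supremum norm on $K$ (the restrictions of $f_i,h_i$ to $K$ being defined for $i$ sufficiently large) and ${}^{(n)}$ is the $n$-th derivative.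
   Context: Let $g^n$ be the round metric of curvature $1$ on $S^n$. The group $G=SO(k+1)\times SO(l+1)$ acts on $M$ with cohomogeneity one (linearly on $S^{k+1}\subset\mathbb R^{k+1}\oplus\mathbb R$ and $S^l\subset\mathbb R^{l+1}$, respectively on $S^{k+l+1}\subset\mathbb R^{k+1}\oplus\mathbb R^{l+1}$), with principal orbits $S^k\times S^l$ and two singular orbits. Böhm metric on $M$: a smooth Einstein metric ($\operatorname{Ric}(g)=\Lambda g$, $\Lambda>0$) which on the complement $(0,\mathfrak T)\times S^k\times S^l$ of the singular orbits has the form $g=dt^2+f(t)^2g^k+h(t)^2g^l$, with $f,h$ smooth on $[0,\mathfrak T]$ and positive on $(0,\mathfrak T)$, where $\mathfrak T>0$ is the distance between the singular orbits, and with boundary conditions $f(0)=0$, $f'(0)=1$, $h(0)=\bar h>0$, $h'(0)=0$, and - if $M=S^{k+1}\times S^l$: $f(\mathfrak T)=0$, $f'(\mathfrak T)=-1$, $h(\mathfrak T)=\bar h$, $h'(\mathfrak T)=0$; - if $M=S^{k+l+1}$: $f(\mathfrak T)=\bar f>0$, $f'(\mathfrak T)=0$, $h(\mathfrak T)=0$, $h'(\mathfrak T)=-1$. The Einstein equations for such a metric are $\Lambda=-\left(k\frac{f''}{f}+l\frac{h''}{h}\right)$, $\ \Lambda=-\frac{f''}{f}+(k-1)\frac{1-f'^2}{f^2}-l\frac{f'h'}{fh}$, $\ \Lambda=-\frac{h''}{h}+(l-1)\frac{1-h'^2}{h^2}-k\frac{f'h'}{fh}$. Sequence of Böhm metrics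 on $M$: a sequence $(g_i)$ of pairwise non-isometric Böhm metrics on the fixed manifold $M$, all with Einstein constant $\Lambda=k+l$, with initial conditions $\bar h_i\to0$ (and $(\bar h_i)$ decreasing if $M=S^{k+1}\times S^l$); $f_i,h_i:[0,\mathfrak T_i]\to\mathbb R$ denote the functions $f,h$ of $g_i$. Böhm proved that such sequences exist and that $\mathfrak T_i\leqslant\pi$ and $\mathfrak T_i\to\pi$. *)

(* Defs.v *)
From Stdlib Require Import Reals.
From Coquelicot Require Import Coquelicot.
Open Scope R_scope.

Definition segment (a b : R) : R -> Prop := fun t => a <= t <= b.

(** One-sided derivatives are used at the end points of [D]: [D_in] is the
    derivative along points of [D]. *)
Definition smooth_on (D : R -> Prop) (u : R -> R) : Prop :=
  exists U : nat -> R -> R,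
    (forall t, D t -> U 0%nat t = u t) /\
    (forall n t, D t -> D_in (U n) (U (S n)) D t).

(** * Cohomogeneity one metrics dt^2 + f(t)^2 g^k + h(t)^2 g^l *)

Inductive manifold : Set :=
  | Sphere           (** S^(k+l+1) *)
  | ProductOfSpheres (** S^(k+1) x S^l *).

(** The values of [prof_f] and [prof_h] outside [0, prof_T] are irrelevant. *)
Record profile := Profile { prof_T : R; prof_f : R -> R; prof_h : R -> R }.

(** Ric = Lambda g on (0, T) x S^k x S^l, written out for the metric
    dt^2 + f^2 g^k + h^2 g^l. *)
Definition einstein_equations (k l : nat) (Lambda : R) (g : profile) : Prop :=
  let f := prof_f g in
  let h := prof_h g in
  forall t, 0 < t < prof_T g ->
    Lambda = - (INR k * (Derive_n f 2 t / f t) + INR l * (Derive_n h 2 t / h t))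
    /\
    Lambda = - (Derive_n f 2 t / f t)
             + (INR k - 1) * ((1 - Derive f t ^ 2) / f t ^ 2)
             - INR l * ((Derive f t * Derive h t) / (f t * h t))
    /\
    Lambda = - (Derive_n h 2 t / h t)
             + (INR l - 1) * ((1 - Derive h t ^ 2) / h t ^ 2)
             - INR k * ((Derive f t * Derive h t) / (f t * h t)).

Definition boundary_conditions (M : manifold) (g : profile) : Prop :=
  let T := prof_T g in
  let f := prof_f g in
  let h := prof_h g in
  let has_slope u t v := D_in u (fun _ => v) (segment 0 T) t in
  (f 0 = 0 /\ has_slope f 0 1 /\ 0 < h 0 /\ has_slope h 0 0) /\
  match M with
  | ProductOfSpheres =>
      f T = 0 /\ has_slope f T (-1) /\ h T = h 0 /\ has_slope h T 0
  | Sphere =>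
      0 < f T /\ has_slope f T 0 /\ h T = 0 /\ has_slope h T (-1)
  end.

Definition even_at_0 (T : R) (u : R -> R) : Prop :=
  forall n t, Rabs t < T -> ex_derive_n (fun s => u (Rabs s)) n t.

Definition odd_at_0 (T : R) (u : R -> R) : Prop :=
  forall n t, Rabs t < T -> ex_derive_n (fun s => sign s * u (Rabs s)) n t.

(** Smoothness of the metric across the two singular orbits.  Given the
    boundary conditions, it means that the radius of the sphere that collapses
    extends to a smooth odd function of the signed distance to the orbit, and
    the radius of the other sphere to a smooth even function. *)
Definition smooth_at_singular_orbits (M : manifold) (g : profile) : Prop :=
  let T := prof_T g in
  let f := prof_f g in
  let h := prof_h g in
  let f_end s := f (T - s) in
  let h_end s := h (T - s) in
  (odd_at_0 T f /\ even_at_0 T h) /\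
  match M with
  | ProductOfSpheres => odd_at_0 T f_end /\ even_at_0 T h_end
  | Sphere => even_at_0 T f_end /\ odd_at_0 T h_end
  end.

(** A Boehm metric on [M] with Einstein constant [Lambda]. *)
Record bohm_metric (k l : nat) (M : manifold) (Lambda : R) (g : profile)
  : Prop := {
  bohm_Lambda_pos : 0 < Lambda;
  bohm_T_pos : 0 < prof_T g;
  bohm_f_smooth : smooth_on (segment 0 (prof_T g)) (prof_f g);
  bohm_h_smooth : smooth_on (segment 0 (prof_T g)) (prof_h g);
  bohm_f_pos : forall t, 0 < t < prof_T g -> 0 < prof_f g t;
  bohm_h_pos : forall t, 0 < t < prof_T g -> 0 < prof_h g t;
  bohm_boundary : boundary_conditions M g;
  bohm_metric_smooth : smooth_at_singular_orbits M g;
  bohm_einstein : einstein_equations k l Lambda g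
}.

(** * Isometry *)

(** |x|^2 in R^(m+1); only the coordinates 0, ..., m of [x] count. *)
Definition sqnorm (m : nat) (x : nat -> R) : R :=
  sum_f_R0 (fun a => x a ^ 2) m.

Record point := Point { pt_t : R; pt_x : nat -> R; pt_y : nat -> R }.

(** [0, T] x S^k x S^l.  It maps onto the manifold by collapsing, at t = 0 and
    t = T, the sphere whose radius vanishes there. *)
Definition is_point (k l : nat) (g : profile) (p : point) : Prop :=
  0 <= pt_t p <= prof_T g /\ sqnorm k (pt_x p) = 1 /\ sqnorm l (pt_y p) = 1.

Definition C1_on_01 (u : R -> R) : Prop :=
  forall s, 0 <= s <= 1 -> ex_derive u s /\ continuous (Derive u) s.

(** Velocity zero is allowed, so that corners need no separate treatment. *)
Definition C1_curve (k l : nat) (g : profile) (c : R -> point) (p q : point)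
  : Prop :=
  (forall s, 0 <= s <= 1 -> is_point k l g (c s)) /\
  C1_on_01 (fun s => pt_t (c s)) /\
  (forall a, (a <= k)%nat -> C1_on_01 (fun s => pt_x (c s) a)) /\
  (forall b, (b <= l)%nat -> C1_on_01 (fun s => pt_y (c s) b)) /\
  c 0 = p /\ c 1 = q.

Definition curve_length (k l : nat) (g : profile) (c : R -> point) : R :=
  RInt (fun s =>
    sqrt (Derive (fun r => pt_t (c r)) s ^ 2
          + prof_f g (pt_t (c s)) ^ 2
            * sqnorm k (fun a => Derive (fun r => pt_x (c r) a) s)
          + prof_h g (pt_t (c s)) ^ 2
            * sqnorm l (fun b => Derive (fun r => pt_y (c r) b) s))) 0 1.

(** The Riemannian distance, pulled back to [0, T] x S^k x S^l: it is 0 exactly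
    between representatives of the same point of the manifold. *)
Definition riem_dist (k l : nat) (g : profile) (p q : point) : Rbar :=
  Glb_Rbar (fun L => exists c, C1_curve k l g c p q /\ L = curve_length k l g c).

(** Riemannian isometries are the bijections preserving the Riemannian distance
    (Myers-Steenrod).  [phi] is such a bijection, described on
    representatives. *)
Definition isometric (k l : nat) (g1 g2 : profile) : Prop :=
  exists phi : point -> point,
    (forall p, is_point k l g1 p -> is_point k l g2 (phi p)) /\
    (forall p q, is_point k l g1 p -> is_point k l g1 q ->
       riem_dist k l g2 (phi p) (phi q) = riem_dist k l g1 p q) /\
    (forall q, is_point k l g2 q ->
       exists p, is_point k l g1 p /\ riem_dist k l g2 (phi p) q = Finite 0).

(** * Sequences of Boehm metrics and their limit *)

Record bohm_sequence (k l : nat) (M : manifold) (g : nat -> profile) : Prop := {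
  bseq_metric : forall i, bohm_metric k l M (INR (k + l)) (g i);
  bseq_distinct : forall i j, i <> j -> ~ isometric k l (g i) (g j);
  bseq_h0_lim : is_lim_seq (fun i => prof_h (g i) 0) 0;
  bseq_h0_decreasing :
    M = ProductOfSpheres -> Un_decreasing (fun i => prof_h (g i) 0)
}.

Definition f_c (k l : nat) (t : R) : R :=
  sqrt ((INR k - 1) / (INR k + INR l - 1)) * sin t.

Definition h_c (k l : nat) (t : R) : R :=
  sqrt ((INR l - 1) / (INR k + INR l - 1)) * sin t.

(** Takes the value [p_infty] on functions unbounded on [K]; the value 0 is
    adjoined so that the norm is 0 when [K] is empty. *)
Definition sup_norm (K : R -> Prop) (u : R -> R) : Rbar :=
  Lub_Rbar (fun y => y = 0 \/ exists t, K t /\ y = Rabs (u t)).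

(** Convergence to 0 of a sequence in [0, +oo]. *)
Definition norms_tend_to_0 (N : nat -> Rbar) : Prop :=
  forall eps, 0 < eps -> eventually (fun i => Rbar_lt (N i) (Finite eps)).

(* Main.v *)
Require Import Defs.
From Stdlib Require Import Reals Lra Lia Psatz Classical.
From Coquelicot Require Import Coquelicot.
Open Scope R_scope.

(** Write n = k + l and let A, B be the radii of the cone,
    A^2 = (k-1)/(n-1), B^2 = (l-1)/(n-1).  In the variables
<<
    w = (f/A)^(k/n) (h/B)^(l/n),   s = (ln (f/A) - ln (h/B)) / n,   z = w s'
>>
    f = A w e^(l s) and h = B w e^(-k s), the cone metric is w = sin t, s = 0,
    and the volume of the orbits is a multiple of w^n.  The Einstein equations
    become those of an oscillator s with friction coefficient n w' / w:
<<
    w'' = - w - k l z^2 / w,     w'^2 + w^2 = 1 + E(s, z),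
    E = (k e^(-2ls) + l e^(2ks)) / n - 1 + k l / (n-1) z^2,
    E' = - 2 k l w' z^2 / w.
>>
    The function E ([excess]) is nonnegative and vanishes only at the shape of
    the cone, so it measures the distance to the cone solution.  It is Boehm's
    Lyapunov function: it decreases as long as the orbits grow.

    Three regimes succeed each other.  At times comparable with h(0) a barrier
    argument keeps f' and h' bounded, and since the equations are nearly
    scale invariant there, E is bounded at such a time by a constant that does
    not depend on h(0), whereas w is of the order of h(0)
    ([initial_layer]).  While w then grows to a fixed small size, w' is at
    least 1/2 and the oscillator is damped in the time ln w; the amount of that
    time is of the order of - ln h(0), so E becomes arbitrarily small when
    h(0) does ([damping]).  From there on E can grow again once w decreases,
    but only by a factor that stays bounded as long as w does not come close to
    0; a Gronwall estimate and a continuity argument show that w follows the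
    sine up to any time smaller than pi ([stability]).  In particular the
    second singular orbit, where w = 0, cannot be reached before that time.
    The three regimes give convergence of f, h, f', h' on compact subsets of
    (0, pi) ([warped_convergence]).

    By the Einstein equations every derivative of f and of h is a polynomial in
    f, f', 1/f, h, h', 1/h, the same one for every solution ([Derive_n_jet]).
    The cone is a solution too, so convergence of the first derivatives gives
    convergence of all of them. *)

(** * Real induction and first passage times *)

(** Induction along an interval, which turns the bootstrap arguments below into
    two local steps: a property persists for a short time, and it passes to the
    end of a half-open interval. *)
Lemma real_induction (a b : R) (P : R -> Prop) :
  P a ->
  (forall c, a <= c < b -> (forall t, a <= t <= c -> P t) ->
     exists d, 0 < d /\ forall t, c < t < c + d -> t <= b -> P t) ->
  (forall c, a < c <= b -> (forall t, a <= t < c -> P t) -> P c) ->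
  forall t, a <= t <= b -> P t.
Proof.
  intros Ha Hopen Hclosed.
  intros t0 Ht0.
  set (E := fun c => a <= c <= b /\ forall t, a <= t <= c -> P t).
  assert (Ea : E a).
  { split; [lra|]. intros t Ht. now replace t with a by lra. }
  destruct (completeness E) as [c [Hub Hlub]].
  { exists b. intros x [Hx _]. lra. }
  { now exists a. }
  assert (Hac : a <= c) by (now apply Hub).
  assert (Hcb : c <= b).
  { apply Hlub. intros x [Hx _]. lra. }
  assert (Hbelow : forall t, a <= t < c -> P t).
  { intros t Ht.
    destruct (classic (exists x, E x /\ t < x)) as [[x [[Hx Ex] Htx]]|Hno].
    - apply Ex. lra.
    - exfalso. assert (c <= t); [|lra].
      apply Hlub. intros x Ex.
      destruct (Rle_or_lt x t) as [|Hlt]; [easy|]. exfalso. apply Hno. now exists x. }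
  assert (Pc : P c).
  { destruct (Rle_lt_or_eq_dec a c Hac) as [Hlt|Heq].
    - apply Hclosed; [lra|easy].
    - now rewrite <- Heq. }
  assert (Ec : E c).
  { split; [lra|]. intros t Ht.
    destruct (Rle_lt_or_eq_dec t c) as [Hlt|Heq]; [lra|apply Hbelow; lra|now rewrite Heq]. }
  destruct (Rle_lt_or_eq_dec c b Hcb) as [Hlt|Heq].
  - destruct (Hopen c) as [d [Hd Hext]]; [lra|apply Ec|].
    assert (Hc' : E (Rmin b (c + d / 2))).
    { assert (Hm1 := Rmin_l b (c + d / 2)). assert (Hm2 := Rmin_r b (c + d / 2)).
      assert (Hm3 : c < Rmin b (c + d / 2)) by (apply Rmin_glb_lt; lra).
      split; [lra|].
      intros t Ht. destruct (Rle_or_lt t c) as [Htc|Htc].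
      - apply Ec. lra.
      - apply Hext; lra. }
    apply Hub in Hc'.
    assert (c < Rmin b (c + d / 2)) by (apply Rmin_glb_lt; lra). lra.
  - apply Ec. lra.
Qed.

Lemma le_of_derive_nonneg (u du : R -> R) (a b : R) :
  a <= b ->
  (forall t, a <= t <= b -> is_derive u t (du t)) ->
  (forall t, a < t < b -> 0 <= du t) ->
  u a <= u b.
Proof.
  intros Hab Hu Hdu.
  destruct (Rle_lt_or_eq_dec a b Hab) as [Hlt|Heq]; [|rewrite Heq; lra].
  destruct (MVT_cor2 u du a b Hlt) as [c [Hc1 Hc2]].
  { intros t Ht. apply is_derive_Reals. now apply Hu. }
  assert (Hc := Hdu c Hc2). nra.
Qed.

Lemma continuous_of_derive (u : R -> R) (t l : R) :
  is_derive u t l -> continuous u t.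
Proof.
  intros H. apply (ex_derive_continuous u). now exists l.
Qed.

Lemma continuous_lt_locally (u : R -> R) (t y : R) :
  continuous u t -> u t < y ->
  exists d, 0 < d /\ forall x, Rabs (x - t) < d -> u x < y.
Proof.
  intros Hc Hy.
  assert (He : 0 < y - u t) by lra.
  destruct (proj1 (filterlim_locally u (u t)) Hc (mkposreal _ He)) as [d Hd].
  exists d. split; [apply cond_pos|].
  intros x Hx. specialize (Hd x Hx).
  change (Rabs (u x - u t) < y - u t) in Hd.
  apply Rabs_def2 in Hd. lra.
Qed.

(** Existence of a first passage time. *)
Lemma first_passage (u : R -> R) (a b y : R) :
  a <= b -> (forall t, a <= t <= b -> continuous u t) -> u a < y <= u b ->
  exists c, a < c <= b /\ u c = y /\ forall t, a <= t < c -> u t < y.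
Proof.
  intros Hab Hcont Hy.
  apply NNPP. intros Hno.
  assert (H : forall t, a <= t <= b -> u t < y).
  { apply real_induction.
    - lra.
    - intros c Hc Hbelow.
      destruct (continuous_lt_locally u c y) as [d [Hd Hd']].
      + apply Hcont. lra.
      + apply Hbelow. lra.
      + exists d. split; [easy|]. intros t Ht _. apply Hd'. apply Rabs_def1; lra.
    - intros c Hc Hbelow.
      destruct (Rtotal_order (u c) y) as [Hlt|[Heq|Hgt]]; [easy| |]; exfalso.
      + apply Hno. now exists c.
      + destruct (continuous_lt_locally (fun t => - u t) c (- y)) as [d [Hd Hd']].
        * apply (continuous_opp u). apply Hcont. lra.
        * lra.
        * assert (Hm1 := Rmax_l a (c - d / 2)). assert (Hm2 := Rmax_r a (c - d / 2)).
          assert (Hm3 : Rmax a (c - d / 2) < c) by (apply Rmax_lub_lt; lra).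
          specialize (Hd' (Rmax a (c - d / 2))). specialize (Hbelow (Rmax a (c - d / 2))).
          assert (- u (Rmax a (c - d / 2)) < - y) by (apply Hd'; apply Rabs_def1; lra).
          assert (u (Rmax a (c - d / 2)) < y) by (apply Hbelow; lra). lra. }
  assert (u b < y) by (apply H; lra). lra.
Qed.

Lemma div_le (a b c : R) : 0 < c -> a <= b * c -> a / c <= b.
Proof. intros Hc. now apply Rle_div_l. Qed.

Lemma le_div (a b c : R) : 0 < c -> a * c <= b -> a <= b / c.
Proof. intros Hc. now apply Rle_div_r. Qed.

(** * The conformal form of the Einstein equations *)

(** Minus the derivative of [shape_excess] in s, up to the factor 2 k l / (k + l). *)
Definition shape_force (k l s : R) : R := exp (- (2 * l * s)) - exp (2 * k * s).

(** Up to an affine normalization, the scalar curvature of the orbit S^k x S^l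
    rescaled to volume 1, as a function of its shape s.  It is convex with
    minimum 0 at s = 0. *)
Definition shape_excess (k l s : R) : R :=
  (k * exp (- (2 * l * s)) + l * exp (2 * k * s)) / (k + l) - 1.

(** Potential plus kinetic energy of the oscillator; with this coefficient of z^2
    the forces cancel in [excess_derive]. *)
Definition excess (k l s z : R) : R :=
  shape_excess k l s + k * l / (k + l - 1) * z ^ 2.

(** The variable z = w s' is the velocity of the shape s in the time tau with
    dt = w dtau, in which the friction coefficient is (k+l-1) w'.  By
    [cf_collapse] the orbits collapse at time T. *)
Record conformal_flow (k l T : R) (w wp s z : R -> R) : Prop := {
  cf_pos : forall t, 0 < t < T -> 0 < w t;
  cf_w : forall t, 0 < t < T -> is_derive w t (wp t);
  cf_wp : forall t, 0 < t < T ->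
    is_derive wp t (- w t - k * l * z t ^ 2 / w t);
  cf_s : forall t, 0 < t < T -> is_derive s t (z t / w t);
  cf_z : forall t, 0 < t < T ->
    is_derive z t ((- (k + l - 1) * wp t * z t
                    + (k + l - 1) / (k + l) * shape_force k l (s t)) / w t);
  cf_constraint : forall t, 0 < t < T ->
    wp t ^ 2 + w t ^ 2 = 1 + excess k l (s t) (z t);
  cf_collapse : forall a d, a < T -> 0 < d -> exists t, a < t < T /\ w t < d
}.

Arguments cf_pos {k l T w wp s z} _ t _.
Arguments cf_w {k l T w wp s z} _ t _.
Arguments cf_wp {k l T w wp s z} _ t _.
Arguments cf_s {k l T w wp s z} _ t _.
Arguments cf_z {k l T w wp s z} _ t _.
Arguments cf_constraint {k l T w wp s z} _ t _.
Arguments cf_collapse {k l T w wp s z} _ a d _ _.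

(** The tangent inequality for exp, whose linear terms cancel because the
    exponents have weighted mean 0. *)
Lemma shape_excess_nonneg (k l s : R) : 0 < k -> 0 < l -> 0 <= shape_excess k l s.
Proof.
  intros Hk Hl. unfold shape_excess.
  assert (H1 := exp_ineq1_le (- (2 * l * s))).
  assert (H2 := exp_ineq1_le (2 * k * s)).
  assert (k + l <= k * exp (- (2 * l * s)) + l * exp (2 * k * s)) by nra.
  apply Rle_minus_r. rewrite Rplus_0_l. apply Rle_div_r; lra.
Qed.

Lemma z_coef_ge_1 (k l : R) : 2 <= k -> 2 <= l -> 1 <= k * l / (k + l - 1).
Proof. intros Hk Hl. apply Rle_div_r; nra. Qed.

Lemma weighted_z_le_excess (k l s z : R) : 2 <= k -> 2 <= l ->
  k * l * z ^ 2 <= (k + l - 1) * excess k l s z.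
Proof.
  intros Hk Hl. unfold excess. assert (H := shape_excess_nonneg k l s).
  replace ((k + l - 1) * _)
    with ((k + l - 1) * shape_excess k l s + k * l * z ^ 2) by (field; lra).
  nra.
Qed.

Lemma excess_controls_z (k l s z : R) : 2 <= k -> 2 <= l -> z ^ 2 <= excess k l s z.
Proof.
  intros Hk Hl. unfold excess.
  assert (H := shape_excess_nonneg k l s). assert (H' := z_coef_ge_1 k l Hk Hl).
  assert (0 <= z ^ 2) by apply pow2_ge_0. nra.
Qed.

Lemma excess_nonneg (k l s z : R) : 2 <= k -> 2 <= l -> 0 <= excess k l s z.
Proof.
  intros Hk Hl. assert (H := excess_controls_z k l s z Hk Hl).
  assert (0 <= z ^ 2) by apply pow2_ge_0. lra.
Qed.

Lemma shape_excess_le_excess (k l s z : R) :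
  2 <= k -> 2 <= l -> shape_excess k l s <= excess k l s z.
Proof.
  intros Hk Hl. unfold excess. assert (H' := z_coef_ge_1 k l Hk Hl).
  assert (0 <= z ^ 2) by apply pow2_ge_0. nra.
Qed.

Lemma exp_le_shape_excess (k l s : R) : 2 <= k -> 2 <= l ->
  exp (- (2 * l * s)) <= (k + l) * (1 + shape_excess k l s) /\
  exp (2 * k * s) <= (k + l) * (1 + shape_excess k l s).
Proof.
  intros Hk Hl. unfold shape_excess.
  assert (H1 := exp_pos (- (2 * l * s))). assert (H2 := exp_pos (2 * k * s)).
  replace ((k + l) * _) with (k * exp (- (2 * l * s)) + l * exp (2 * k * s)) by (field; lra).
  nra.
Qed.

Lemma shape_force_abs_ge (k l s : R) : 2 <= k -> 2 <= l ->
  - (shape_force k l s * s) <= shape_force k l s ^ 2 / 4.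
Proof.
  intros Hk Hl. unfold shape_force.
  assert (H1 := exp_ineq1_le (- (2 * l * s))).
  assert (H2 := exp_ineq1_le (2 * k * s)).
  destruct (Rle_or_lt 0 s) as [Hs|Hs].
  - assert (exp (- (2 * l * s)) <= 1).
    { rewrite <- exp_0. destruct (Rle_lt_or_eq_dec 0 s Hs) as [H|H].
      - left. apply exp_increasing. nra.
      - right. f_equal. rewrite <- H. ring. }
    assert (4 * s <= exp (2 * k * s) - exp (- (2 * l * s))) by nra.
    nra.
  - assert (exp (2 * k * s) < 1).
    { rewrite <- exp_0. apply exp_increasing. nra. }
    assert (4 * - s <= exp (- (2 * l * s)) - exp (2 * k * s)) by nra.
    nra.
Qed.

(** By convexity the excess is at most its derivative times s, and the
    restoring force grows at least linearly in s.  So dissipating the squared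
    force amounts to dissipating potential energy. *)
Lemma shape_excess_le_force (k l s : R) : 2 <= k -> 2 <= l ->
  shape_excess k l s <= k * l * (shape_force k l s ^ 2 / 4).
Proof.
  intros Hk Hl.
  assert (Htan : forall x, exp x - 1 <= exp x * x).
  { intros x. assert (H := exp_ineq1_le (- x)). rewrite exp_Ropp in H.
    assert (Hp := exp_pos x).
    apply (Rmult_le_compat_l (exp x)) in H; [|lra].
    rewrite Rinv_r in H; lra. }
  assert (H1 := Htan (- (2 * l * s))). assert (H2 := Htan (2 * k * s)).
  assert (H3 := shape_force_abs_ge k l s Hk Hl).
  assert (H4 : shape_excess k l s <= 2 * k * l / (k + l) * (- (shape_force k l s * s))).
  { unfold shape_excess, shape_force.
    apply Rle_minus_l. apply Rle_div_l; [lra|].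
    match goal with |- _ <= ?r => replace r with
     (k * (exp (- (2 * l * s)) * (- (2 * l * s))) + l * (exp (2 * k * s) * (2 * k * s)) + (k + l)) end.
    - nra.
    - field. lra. }
  eapply Rle_trans; [exact H4|].
  assert (H5 : 2 * k * l / (k + l) <= k * l).
  { apply Rle_div_l; [lra|]. assert (0 <= k * l) by nra. nra. }
  assert (0 <= 2 * k * l / (k + l)) by (apply Rle_div_r; nra).
  assert (0 <= shape_force k l s ^ 2) by apply pow2_ge_0.
  eapply Rle_trans; [apply Rmult_le_compat_l; [easy|exact H3]|].
  apply Rmult_le_compat_r; lra.
Qed.

(** The second order term gives the coercivity of [shape_excess] at s = 0. *)
Lemma exp_ge_quadratic (x : R) : 0 <= x -> 1 + x + x ^ 2 / 2 <= exp x.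
Proof.
  intros Hx.
  assert (H : 0 <= exp x - (1 + x + x ^ 2 / 2)); [|lra].
  replace 0 with ((fun y => exp y - (1 + y + y ^ 2 / 2)) 0).
  2:{ simpl. rewrite exp_0. lra. }
  apply (le_of_derive_nonneg (fun y => exp y - (1 + y + y ^ 2 / 2))
           (fun y => exp y - (1 + y)) 0 x Hx).
  - intros t _. auto_derive; [easy|]. field.
  - intros t _. assert (H := exp_ineq1_le t). lra.
Qed.

Lemma shape_excess_controls_s (k l s : R) : 2 <= k -> 2 <= l ->
  s ^ 2 <= shape_excess k l s.
Proof.
  intros Hk Hl. unfold shape_excess.
  apply Rle_minus_r. apply Rle_div_r; [lra|].
  assert (H1 := exp_ineq1_le (- (2 * l * s))).
  assert (H2 := exp_ineq1_le (2 * k * s)).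
  assert (Hs2 : 0 <= s ^ 2) by nra.
  assert (Hkl : 4 <= k * l) by nra.
  destruct (Rle_or_lt 0 s) as [Hs|Hs].
  - assert (H3 := exp_ge_quadratic (2 * k * s)).
    assert (H4 : 1 + 2 * k * s + (2 * k * s) ^ 2 / 2 <= exp (2 * k * s)) by (apply H3; nra).
    assert (k + l <= 2 * k * (k * l)) by nra.
    assert ((k + l) * s ^ 2 <= 2 * k * (k * l) * s ^ 2) by (apply Rmult_le_compat_r; lra).
    assert (l * (1 + 2 * k * s + (2 * k * s) ^ 2 / 2) <= l * exp (2 * k * s)) by (apply Rmult_le_compat_l; lra).
    assert (k * (1 + - (2 * l * s)) <= k * exp (- (2 * l * s))) by (apply Rmult_le_compat_l; lra).
    nra.
  - assert (H3 := exp_ge_quadratic (- (2 * l * s))).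
    assert (H4 : 1 + - (2 * l * s) + (- (2 * l * s)) ^ 2 / 2 <= exp (- (2 * l * s))) by (apply H3; nra).
    assert (k + l <= 2 * l * (k * l)) by nra.
    assert ((k + l) * s ^ 2 <= 2 * l * (k * l) * s ^ 2) by (apply Rmult_le_compat_r; lra).
    assert (k * (1 + - (2 * l * s) + (- (2 * l * s)) ^ 2 / 2) <= k * exp (- (2 * l * s))) by (apply Rmult_le_compat_l; lra).
    assert (l * (1 + (2 * k * s)) <= l * exp (2 * k * s)) by (apply Rmult_le_compat_l; lra).
    nra.
Qed.

(** * Damping while w increases *)

Section Damping.
Variables (k l T : R) (w wp s z : R -> R).
Hypothesis (Hk : 2 <= k) (Hl : 2 <= l).
Hypothesis (F : conformal_flow k l T w wp s z).

(** The forces cancel in the derivative of the energy; only friction remains,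
    and it has the sign of - w'. *)
Lemma excess_derive (t : R) : 0 < t < T ->
  is_derive (fun t => excess k l (s t) (z t)) t (- (2 * k * l * (wp t * z t ^ 2 / w t))).
Proof.
  intros Ht.
  assert (Hw := cf_pos F t Ht).
  assert (Hs := cf_s F t Ht).
  assert (Hz := cf_z F t Ht).
  unfold excess, shape_excess.
  auto_derive.
  - repeat split; eexists; eassumption.
  - erewrite (is_derive_unique _ t) by exact Hs.
    erewrite (is_derive_unique _ t) by exact Hz.
    unfold shape_force. field. repeat split; lra.
Qed.

(** The cross term of the modified energy: its derivative contains the squared
    force, which the derivative of the energy lacks. *)
Lemma force_z_derive (t : R) : 0 < t < T ->
  is_derive (fun t => shape_force k l (s t) * z t) t
    ((- (2 * l * exp (- (2 * l * s t)) + 2 * k * exp (2 * k * s t)) * z t ^ 2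
      - (k + l - 1) * wp t * (shape_force k l (s t) * z t)
      + (k + l - 1) / (k + l) * shape_force k l (s t) ^ 2) / w t).
Proof.
  intros Ht.
  assert (Hw := cf_pos F t Ht).
  assert (Hs := cf_s F t Ht).
  assert (Hz := cf_z F t Ht).
  unfold shape_force in *.
  auto_derive.
  - repeat split; eexists; eassumption.
  - erewrite (is_derive_unique _ t) by exact Hs.
    erewrite (is_derive_unique _ t) by exact Hz.
    field. repeat split; lra.
Qed.

(** At a zero of w' the constraint would give w^2 = 1 + E, hence w at least 1. *)
Lemma w_rising (a b : R) : 0 < a -> a <= b < T -> 0 < wp a ->
  (forall t, a <= t < b -> w t < 1) -> forall t, a <= t < b -> 0 < wp t.
Proof.
  intros Ha Hb Hwa Hw t Ht.
  assert (Hne : forall x, a <= x < b -> wp x <> 0).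
  { intros x Hx H0.
    assert (Hc := cf_constraint F x ltac:(lra)).
    assert (Hx1 := Hw x Hx). assert (Hx0 := cf_pos F x ltac:(lra)).
    assert (He := excess_nonneg k l (s x) (z x) Hk Hl).
    rewrite H0 in Hc. nra. }
  destruct (Rlt_or_le 0 (wp t)) as [|Hneg]; [easy|].
  destruct (first_passage (fun t => - wp t) a t 0) as [c [Hc1 [Hc2 _]]].
  - lra.
  - intros x Hx. apply (continuous_opp wp).
    eapply continuous_of_derive, (cf_wp F). lra.
  - lra.
  - exfalso. apply (Hne c); lra.
Qed.

Lemma w_rising_rate (t : R) : 0 < t < T -> 0 < wp t -> w t <= 1 / 2 -> 1 / 2 <= wp t.
Proof.
  intros Ht Hp Hw.
  assert (Hc := cf_constraint F t Ht).
  assert (Hx0 := cf_pos F t Ht).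
  assert (He := excess_nonneg k l (s t) (z t) Hk Hl).
  nra.
Qed.

Lemma excess_nonincreasing (a b : R) : 0 < a -> a <= b < T ->
  (forall t, a <= t < b -> 0 < wp t) ->
  excess k l (s b) (z b) <= excess k l (s a) (z a).
Proof.
  intros Ha Hab Hp.
  apply Ropp_le_cancel.
  apply (le_of_derive_nonneg (fun t => - excess k l (s t) (z t))
    (fun t => (2 * k * l * (wp t * z t ^ 2 / w t)))); [lra| |].
  - intros t Ht.
    assert (H := excess_derive t ltac:(lra)).
    apply (is_derive_opp (fun t => excess k l (s t) (z t))) in H.
    replace (2 * k * l * (wp t * z t ^ 2 / w t)) with (opp (- (2 * k * l * (wp t * z t ^ 2 / w t)))); [exact H|].
    change (- - (2 * k * l * (wp t * z t ^ 2 / w t)) = 2 * k * l * (wp t * z t ^ 2 / w t)). ring.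
  - intros t Ht. assert (Hw := cf_pos F t ltac:(lra)).
    assert (Hpt := Hp t ltac:(lra)).
    assert (0 <= wp t * z t ^ 2 / w t).
    { apply Rle_div_r; [lra|]. rewrite Rmult_0_l. apply Rmult_le_pos; [lra|nra]. }
    assert (0 <= k * l) by nra. nra.
Qed.

(** The function Q z - M E - c ln w is nondecreasing for Q = [shape_force], a
    large constant M and c proportional to the final value of E: friction
    dissipates z^2, the cross term Q z converts force into dissipation of Q^2,
    and z^2 + Q^2 / 4 dominates E.  All terms but c ln w are bounded in terms
    of the initial energy, so the final value of E is at most a constant
    divided by the gain of ln w. *)
Lemma damping (a om C0 : R) : 0 < a < T -> 0 < wp a -> w a < om <= 1 / 2 ->
  excess k l (s a) (z a) <= C0 ->
  exists b, a < b < T /\ b <= a + 2 * om /\ w b = om /\ 0 < wp b /\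
    excess k l (s b) (z b) * ln (om / w a) <=
    k * l * (1 + C0) * (((k + l) * (1 + C0)) ^ 2 + C0
      + (2 * (k + l) * ((k + l) * (1 + C0)) + (k + l) ^ 2 * (1 + C0) + 1) * C0).
Proof.
  intros Ha Hpa Hwa HC0.
  assert (HC0' : 0 <= C0).
  { assert (H := excess_nonneg k l (s a) (z a) Hk Hl). lra. }
  assert (Hcont : forall t, 0 < t < T -> continuous w t).
  { intros t Ht. eapply continuous_of_derive, (cf_w F). easy. }
  (* w cannot stay below om, since it must come back to 0 at time T. *)
  assert (Hreach : exists b, a <= b < T /\ om <= w b).
  { apply NNPP. intros Hno.
    assert (Hlow : forall t, a <= t < T -> w t < om).
    { intros t Ht. apply Rnot_le_lt. intros H. apply Hno. now exists t. }
    destruct (cf_collapse F a (w a)) as [t [Ht1 Ht2]]; [lra| |].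
    { apply (cf_pos F). lra. }
    assert (w a <= w t); [|lra].
    apply (le_of_derive_nonneg w wp); [lra| |].
    - intros x Hx. apply (cf_w F). lra.
    - intros x Hx. left. apply (w_rising a t); try lra.
      intros y Hy. assert (Hy' := Hlow y ltac:(lra)). lra. }
  destruct Hreach as [b0 [Hb0 Hwb0]].
  destruct (first_passage w a b0 om) as [b [Hb [Hwb Hbelow]]].
  { lra. }
  { intros t Ht. apply Hcont. lra. }
  { lra. }
  assert (Hp0 : forall t, a <= t < b -> 0 < wp t).
  { apply w_rising; try lra. intros t Ht. assert (H := Hbelow t Ht). lra. }
  assert (Hp : forall t, a <= t < b -> 1 / 2 <= wp t).
  { intros t Ht. apply w_rising_rate; [lra|now apply Hp0|].
    assert (H := Hbelow t Ht). lra. }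
  assert (Hpb : 1 / 2 <= wp b).
  { apply Rnot_lt_le. intros Hlt.
    destruct (continuous_lt_locally wp b (1 / 2)) as [d [Hd Hd']]; [|easy|].
    - eapply continuous_of_derive, (cf_wp F). lra.
    - assert (Hm1 := Rmax_l a (b - d / 2)). assert (Hm2 := Rmax_r a (b - d / 2)).
      assert (Hm3 : Rmax a (b - d / 2) < b) by (apply Rmax_lub_lt; lra).
      assert (H1 := Hd' (Rmax a (b - d / 2)) ltac:(apply Rabs_def1; lra)).
      assert (H2 := Hp (Rmax a (b - d / 2)) ltac:(lra)). lra. }
  exists b. split; [lra|]. split.
  { assert (w a - a / 2 <= w b - b / 2).
    { apply (le_of_derive_nonneg (fun t => w t - t / 2) (fun t => wp t - 1 / 2)); [lra| |].
      - intros t Ht. assert (Hw' := cf_w F t ltac:(lra)). auto_derive.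
        + now exists (wp t).
        + erewrite (is_derive_unique _ t) by exact Hw'. field.
      - intros t Ht. assert (H := Hp t ltac:(lra)). lra. }
    assert (Hwa0 := cf_pos F a ltac:(lra)). lra. }
  split; [easy|]. split; [lra|].
  assert (Hpos : forall t, a <= t <= b -> 0 < w t).
  { intros t Ht. apply (cf_pos F). lra. }
  set (E := (k + l) * (1 + C0)).
  set (M := 2 * (k + l) * E + (k + l) ^ 2 * (1 + C0) + 1).
  set (D := fun t => excess k l (s t) (z t)).
  set (Q := fun t => shape_force k l (s t)).
  fold (D b).
  assert (HD : forall t, a <= t <= b -> D b <= D t <= C0).
  { intros t Ht. split.
    - apply excess_nonincreasing; try lra. intros x Hx. apply Hp0. lra.
    - apply Rle_trans with (D a); [|easy].
      apply excess_nonincreasing; try lra. intros x Hx. apply Hp0. lra. }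
  assert (HD0 : forall t, 0 <= D t).
  { intros t. now apply excess_nonneg. }
  assert (HE : forall t, a <= t <= b -> exp (- (2 * l * s t)) <= E /\ exp (2 * k * s t) <= E).
  { intros t Ht. assert (H := exp_le_shape_excess k l (s t) Hk Hl).
    assert (H2 := shape_excess_le_excess k l (s t) (z t) Hk Hl).
    assert (H3 := HD t Ht). fold (D t) in H2.
    assert ((k + l) * (1 + shape_excess k l (s t)) <= E); [|lra].
    unfold E. apply Rmult_le_compat_l; lra. }
  assert (HQz : forall t, a <= t <= b -> - (E ^ 2 + C0) / 2 <= Q t * z t <= (E ^ 2 + C0) / 2).
  { intros t Ht. assert (H := HE t Ht).
    assert (H1 := exp_pos (- (2 * l * s t))). assert (H2 := exp_pos (2 * k * s t)).
    assert (Q t ^ 2 <= E ^ 2).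
    { unfold Q, shape_force. nra. }
    assert (z t ^ 2 <= C0).
    { assert (H3 := excess_controls_z k l (s t) (z t) Hk Hl).
      assert (H4 := HD t Ht). fold (D t) in H3. lra. }
    assert (Hm := pow2_ge_0 (Q t - z t)). assert (Hp' := pow2_ge_0 (Q t + z t)).
    split; lra. }
  assert (HM : 0 <= M).
  { unfold M, E. assert (0 <= (k + l) ^ 2) by apply pow2_ge_0.
    assert (0 <= (k + l) * (1 + C0)) by nra. nra. }
  set (c := D b / (k * l * (1 + C0))).
  assert (Hmono : Q a * z a - M * D a - c * ln (w a) <= Q b * z b - M * D b - c * ln (w b)).
  { apply (le_of_derive_nonneg (fun t => Q t * z t - M * D t - c * ln (w t))
      (fun t => (- (2 * l * exp (- (2 * l * s t)) + 2 * k * exp (2 * k * s t)) * z t ^ 2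
        - (k + l - 1) * wp t * (shape_force k l (s t) * z t)
        + (k + l - 1) / (k + l) * shape_force k l (s t) ^ 2) / w t
        - M * (- (2 * k * l * (wp t * z t ^ 2 / w t))) - c * (wp t / w t))); [lra| |].
    - intros t Ht.
      apply (is_derive_minus (fun t => Q t * z t - M * D t) (fun t => c * ln (w t))).
      + apply (is_derive_minus (fun t => Q t * z t) (fun t => M * D t)).
        * apply force_z_derive. lra.
        * apply (is_derive_scal D). apply excess_derive. lra.
      + apply (is_derive_scal (fun t => ln (w t)) t c (wp t / w t)).
        assert (Hwt := Hpos t Ht).
        assert (Hw' := cf_w F t ltac:(lra)).
        auto_derive; [split; [now exists (wp t)|easy]|].
        erewrite (is_derive_unique _ t) by exact Hw'. field. lra.
    - intros t Ht.
      assert (Hwt := Hpos t ltac:(lra)).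
      assert (Hpt := Hp t ltac:(lra)).
      assert (HDt := HD t ltac:(lra)).
      destruct (HE t ltac:(lra)) as [HE1 HE2].
      assert (Hp2 : wp t ^ 2 <= 1 + C0).
      { assert (Hc := cf_constraint F t ltac:(lra)). fold (D t) in Hc. nra. }
      assert (HDQ : D t <= k * l * (z t ^ 2 + Q t ^ 2 / 4)).
      { assert (H := shape_excess_le_force k l (s t) Hk Hl). fold (Q t) in H.
        unfold D, excess.
        assert (k * l / (k + l - 1) <= k * l).
        { apply Rle_div_l; [lra|]. assert (0 <= k * l) by nra. nra. }
        assert (0 <= z t ^ 2) by apply pow2_ge_0. nra. }
      fold (Q t).
      set (e1 := exp (- (2 * l * s t))) in *. set (e2 := exp (2 * k * s t)) in *.
      assert (H1 : (2 * l * e1 + 2 * k * e2) * z t ^ 2 <= 2 * (k + l) * E * z t ^ 2).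
      { apply Rmult_le_compat_r; nra. }
      (* Young's inequality absorbs the friction part of the cross term half into
         Q^2 and half into z^2; M is chosen so that M E pays for the latter. *)
      assert (H2 : (k + l - 1) * wp t * (Q t * z t) <=
         (k + l - 1) / (2 * (k + l)) * Q t ^ 2 + (k + l) ^ 2 * (1 + C0) * z t ^ 2).
      { assert (0 <= (Q t - (k + l) * wp t * z t) ^ 2 * ((k + l - 1) / (2 * (k + l)))).
        { apply Rmult_le_pos; [apply pow2_ge_0|]. apply Rle_div_r; lra. }
        assert ((k + l - 1) * (k + l) / 2 * (wp t ^ 2 * z t ^ 2) <= (k + l) ^ 2 * ((1 + C0) * z t ^ 2)).
        { apply Rmult_le_compat; [apply Rle_div_r; nra| |nra|].
          - apply Rmult_le_pos; apply pow2_ge_0.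
          - apply Rmult_le_compat_r; [apply pow2_ge_0|easy]. }
        replace ((Q t - (k + l) * wp t * z t) ^ 2 * ((k + l - 1) / (2 * (k + l)))) with
          ((k + l - 1) / (2 * (k + l)) * Q t ^ 2 + (k + l - 1) * (k + l) / 2 * (wp t ^ 2 * z t ^ 2)
            - (k + l - 1) * wp t * (Q t * z t)) in H by (field; lra).
        lra. }
      assert (H3 : M * z t ^ 2 <= M * (2 * k * l * (wp t * z t ^ 2))).
      { apply Rmult_le_compat_l; [easy|]. assert (Hkl : 4 <= k * l) by nra.
        assert (1 <= 2 * k * l * wp t) by nra.
        assert (0 <= z t ^ 2) by apply pow2_ge_0. nra. }
      assert (H4 : Q t ^ 2 / 4 <= (k + l - 1) / (k + l) * Q t ^ 2 - (k + l - 1) / (2 * (k + l)) * Q t ^ 2).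
      { replace ((k + l - 1) / (k + l) * Q t ^ 2 - (k + l - 1) / (2 * (k + l)) * Q t ^ 2)
          with ((k + l - 1) / (2 * (k + l)) * Q t ^ 2) by (field; lra).
        assert (Hn : / 4 <= (k + l - 1) / (2 * (k + l))).
        { apply Rle_div_r. lra. lra. }
        apply (Rmult_le_compat_r (Q t ^ 2)) in Hn; [lra|apply pow2_ge_0]. }
      assert (H5 : c * wp t <= z t ^ 2 + Q t ^ 2 / 4).
      { unfold c.
        replace (D b / (k * l * (1 + C0)) * wp t) with (D b * wp t / (k * l * (1 + C0))) by (field; repeat split; lra).
        apply Rle_div_l; [repeat apply Rmult_lt_0_compat; lra|].
        assert (wp t <= 1 + C0) by nra.
        assert (D b * wp t <= D t * (1 + C0)) by (apply Rmult_le_compat; try lra; apply HD0).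
        assert (D t * (1 + C0) <= (k * l * (z t ^ 2 + Q t ^ 2 / 4)) * (1 + C0)) by (apply Rmult_le_compat_r; lra).
        lra. }
      match goal with |- 0 <= ?r => replace r with
        ((- (2 * l * e1 + 2 * k * e2) * z t ^ 2 - (k + l - 1) * wp t * (Q t * z t)
          + (k + l - 1) / (k + l) * Q t ^ 2 + M * (2 * k * l * (wp t * z t ^ 2)) - c * wp t) / w t)
        by (field; split; lra) end.
      apply Rle_div_r; [lra|]. rewrite Rmult_0_l.
      unfold M in H3 at 1. lra. }
  assert (HQa := HQz a ltac:(lra)). assert (HQb := HQz b ltac:(lra)).
  assert (HDa := HD a ltac:(lra)). assert (HDb := HD0 b).
  assert (Hln : ln (om / w a) = ln (w b) - ln (w a)).
  { assert (Hwa0 := Hpos a ltac:(lra)). rewrite Hwb, ln_div; [easy|lra|easy]. }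
  rewrite Hln.
  assert (Hfin : c * (ln (w b) - ln (w a)) <= E ^ 2 + C0 + M * C0).
  { assert (M * (D a - D b) <= M * C0) by (apply Rmult_le_compat_l; lra). lra. }
  assert (Hc : D b = k * l * (1 + C0) * c) by (unfold c; field; repeat split; lra).
  rewrite Hc at 1. rewrite Rmult_assoc.
  apply Rmult_le_compat_l; [repeat apply Rmult_le_pos; lra|easy].
Qed.
End Damping.

(** * Stability of the cone solution *)

Lemma sin_ge_min (p q x : R) : 0 <= p <= PI / 2 -> 0 <= q <= PI / 2 ->
  p <= x <= PI - q -> Rmin (sin p) (sin q) <= sin x.
Proof.
  intros Hp Hq Hx.
  destruct (Rle_or_lt x (PI / 2)) as [H|H].
  - apply Rle_trans with (sin p); [apply Rmin_l|]. apply sin_incr_1; lra.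
  - apply Rle_trans with (sin q); [apply Rmin_r|].
    rewrite <- (sin_PI_x x). apply sin_incr_1; lra.
Qed.

Lemma abs_le_of_sq (x y : R) : 0 <= y -> x ^ 2 <= y ^ 2 -> Rabs x <= y.
Proof. intros Hy H. apply Rabs_le. split; nra. Qed.

Lemma abs_lt_of_sq (x y : R) : 0 < y -> x ^ 2 < y ^ 2 -> - y < x < y.
Proof. intros Hy H. split; nra. Qed.

Section Growth.
Variables (k l T : R) (w wp s z : R -> R).
Hypothesis (Hk : 2 <= k) (Hl : 2 <= l).
Hypothesis (F : conformal_flow k l T w wp s z).

(** Friction may be negative here, but the dissipated quantity is at most a
    multiple of the excess. *)
Lemma excess_gronwall (a b del : R) : 0 < a -> a <= b < T -> 0 < del ->
  (forall t, a <= t < b -> del <= w t /\ - 2 <= wp t <= 2) ->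
  excess k l (s b) (z b) <=
  excess k l (s a) (z a) * exp (4 * (k + l - 1) / del * (b - a)).
Proof.
  intros Ha Hb Hdel Hbd.
  set (A := 4 * (k + l - 1) / del).
  set (D := fun t => excess k l (s t) (z t)).
  change (D b <= D a * exp (A * (b - a))).
  assert (H : D b * exp (- (A * (b - a))) <= D a * exp (- (A * (a - a)))).
  { apply Ropp_le_cancel.
    apply (le_of_derive_nonneg (fun t => - (D t * exp (- (A * (t - a)))))
      (fun t => (2 * k * l * (wp t * z t ^ 2 / w t) + A * D t) * exp (- (A * (t - a))))); [lra| |].
    - intros t Ht.
      assert (HD := excess_derive k l T w wp s z Hk Hl F t ltac:(lra)).
      fold D in HD. change (is_derive D t (- (2 * k * l * (wp t * z t ^ 2 / w t)))) in HD.
      assert (Hw := cf_pos F t ltac:(lra)).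
      auto_derive.
      + repeat split; eexists; exact HD.
      + erewrite (is_derive_unique _ t) by exact HD. unfold Rminus, Rdiv. ring.
    - intros t Ht. apply Rmult_le_pos; [|left; apply exp_pos].
      destruct (Hbd t ltac:(lra)) as [Hw Hp].
      assert (HD1 := weighted_z_le_excess k l (s t) (z t) Hk Hl). fold (D t) in HD1.
      assert (Hkl : 0 <= k * l * z t ^ 2).
      { apply Rmult_le_pos; [nra|apply pow2_ge_0]. }
      assert (H0 : k * l * z t ^ 2 / w t <= (k + l - 1) * D t / del).
      { apply Rmult_le_compat; [easy| |easy|].
        - left. apply Rinv_0_lt_compat. lra.
        - apply Rinv_le_contravar; lra. }
      assert (H0' : 0 <= k * l * z t ^ 2 / w t).
      { apply Rdiv_le_0_compat; lra. }
      replace (2 * k * l * (wp t * z t ^ 2 / w t)) with (2 * wp t * (k * l * z t ^ 2 / w t)) by (field; lra).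
      replace (A * D t) with (4 * ((k + l - 1) * D t / del)) by (unfold A; field; lra).
      nra. }
  replace (- (A * (a - a))) with 0 in H by ring. rewrite exp_0, Rmult_1_r in H.
  rewrite exp_Ropp in H. apply Rle_div_l in H; [easy|apply exp_pos].
Qed.
End Growth.

(** The comparison solution is the sine whose value at time a is also om, so
    that the initial error is controlled by the excess alone, whatever om is.
    The squared error (w - sin)^2 + (w' - cos)^2 grows at a rate bounded by the
    excess, because sine and w solve the same equation up to the term
    k l z^2 / w. *)
Lemma stability (k l om e rho : R) : 2 <= k -> 2 <= l ->
  0 < om <= 1 / 2 -> 0 < e < PI / 2 -> 0 < rho ->
  exists d, 0 < d /\
  forall T w wp s z a, conformal_flow k l T w wp s z ->
    0 < a < T -> w a = om -> 0 < wp a -> excess k l (s a) (z a) <= d ->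
    a + (PI - e - asin om) < T /\
    forall t, a <= t <= a + (PI - e - asin om) ->
      Rabs (w t - sin (t - a + asin om)) <= rho /\
      Rabs (wp t - cos (t - a + asin om)) <= rho /\
      excess k l (s t) (z t) <= rho.
Proof.
  intros Hk Hl Hom He Hrho.
  assert (Hpi := PI_RGT_0). assert (Hpi4 := PI_4).
  set (th := asin om).
  assert (Hsin : sin th = om) by (apply sin_asin; lra).
  assert (Hth : 0 < th < PI / 2).
  { assert (Hb := asin_bound_lt om ltac:(lra)). fold th in Hb. split; [|lra].
    apply Rnot_le_lt. intros Hneg.
    assert (H := sin_incr_1 th 0). rewrite sin_0 in H. lra. }
  assert (Hcos : 0 < cos th) by (apply cos_gt_0; lra).
  assert (Hsine : 0 < sin e) by (apply sin_gt_0; lra).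
  assert (Hsine1 := SIN_bound e).
  set (del := Rmin om (sin e) / 2).
  assert (Hdel : 0 < del <= 1 / 2).
  { unfold del. assert (0 < Rmin om (sin e)) by (apply Rmin_glb_lt; lra).
    assert (Hml := Rmin_l om (sin e)). lra. }
  set (mu := Rmin del rho).
  assert (Hmu : 0 < mu) by (apply Rmin_glb_lt; lra).
  assert (Hmud : mu <= del) by apply Rmin_l.
  assert (Hmur : mu <= rho) by apply Rmin_r.
  set (A := 4 * (k + l - 1) / del).
  assert (HA : 0 < A) by (apply Rdiv_lt_0_compat; lra).
  set (G := exp (A * 4)).
  assert (HG : 1 <= G).
  { unfold G. rewrite <- exp_0. left. apply exp_increasing. lra. }
  set (B := 8 * (k + l) * G).
  assert (HB : 1 <= B) by (unfold B; nra).
  set (d := Rmin (mu ^ 2) rho / (2 * B)).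
  assert (Hmin : 0 < Rmin (mu ^ 2) rho) by (apply Rmin_glb_lt; [apply pow_lt|]; lra).
  assert (Hd : 0 < d) by (apply Rdiv_lt_0_compat; lra).
  assert (HdB : d * B < mu ^ 2 /\ d * B < rho).
  { replace (d * B) with (Rmin (mu ^ 2) rho / 2) by (unfold d; field; lra).
    assert (H1 := Rmin_l (mu ^ 2) rho). assert (H2 := Rmin_r (mu ^ 2) rho). lra. }
  exists d. split; [easy|].
  intros T w wp s z a F Ha Hwa Hpa HDa.
  set (D := fun t => excess k l (s t) (z t)). fold (D a) in HDa.
  assert (HD0 : forall t, 0 <= D t) by (intros t; now apply excess_nonneg).
  set (x := fun t => t - a + th).
  set (Rr := fun t => (w t - sin (x t)) ^ 2 + (wp t - cos (x t)) ^ 2).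
  (* The values agree and both derivatives are positive, so the error in w' is
     at most the difference of the squares, which is the excess. *)
  assert (HRa : Rr a <= D a).
  { unfold Rr, x. replace (a - a + th) with th by ring. rewrite Hsin, Hwa.
    assert (Hc := cf_constraint F a Ha). fold (D a) in Hc.
    assert (Hsc := sin2_cos2 th). rewrite Hsin in Hsc. unfold Rsqr in Hsc.
    rewrite Hwa in Hc.
    assert (H0 := HD0 a).
    assert (cos th <= wp a) by nra.
    nra. }
  (* As long as the error stays below mu, w is bounded below by del; this
     bounds the growth of the excess, hence the error. *)
  assert (Hstep : forall c, a <= c < T -> x c <= PI - e ->
    (forall t, a <= t < c -> Rr t < mu ^ 2) ->
    (forall t, a <= t < c -> del <= w t /\ - 2 <= wp t <= 2)).
  { intros c Hc Hxc Hlt t Ht.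
    assert (H := Hlt t Ht). unfold Rr in H.
    assert (H1 := pow2_ge_0 (w t - sin (x t))). assert (H2 := pow2_ge_0 (wp t - cos (x t))).
    assert (H3 := abs_lt_of_sq (w t - sin (x t)) mu Hmu ltac:(lra)).
    assert (H4 := abs_lt_of_sq (wp t - cos (x t)) mu Hmu ltac:(lra)).
    assert (Hs : Rmin (sin th) (sin e) <= sin (x t)).
    { apply sin_ge_min; try lra. unfold x in *. lra. }
    rewrite Hsin in Hs. fold (Rmin om (sin e)) in Hs.
    assert (Hcb := COS_bound (x t)).
    unfold del in *. split; lra. }
  assert (Hbound : forall c, a <= c < T -> x c <= PI - e ->
    (forall t, a <= t < c -> Rr t < mu ^ 2) ->
    D c <= D a * G /\ Rr c <= D a * B).
  { intros c Hc Hxc Hlt.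
    assert (Hb := Hstep c Hc Hxc Hlt).
    assert (HDc : forall t, a <= t <= c -> D t <= D a * G).
    { intros t Ht. eapply Rle_trans.
      - apply (excess_gronwall k l T w wp s z Hk Hl F a t del); try lra.
        intros y Hy. apply Hb. lra.
      - apply Rmult_le_compat_l; [apply HD0|]. unfold G.
        fold A. destruct (Rle_lt_or_eq_dec (A * (t - a)) (A * 4)) as [H|H].
        + apply Rmult_le_compat_l; [lra|]. unfold x in *. lra.
        + left. now apply exp_increasing.
        + rewrite H. lra. }
    split; [apply HDc; lra|].
    assert (HR : Rr c - 2 * (k + l - 1) * (D a * G) * c <= Rr a - 2 * (k + l - 1) * (D a * G) * a).
    { apply Ropp_le_cancel.
      apply (le_of_derive_nonneg (fun t => - (Rr t - 2 * (k + l - 1) * (D a * G) * t))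
        (fun t => 2 * (k + l - 1) * (D a * G) + 2 * (wp t - cos (x t)) * (k * l * z t ^ 2 / w t))); [lra| |].
      - intros t Ht.
        assert (Hw := cf_pos F t ltac:(lra)).
        assert (Hw' := cf_w F t ltac:(lra)).
        assert (Hwp' := cf_wp F t ltac:(lra)).
        unfold Rr, x. auto_derive.
        + repeat split; eexists; eassumption.
        + erewrite (is_derive_unique _ t) by exact Hw'. erewrite (is_derive_unique _ t) by exact Hwp'. fold (t - a). field. lra.
      - intros t Ht.
        destruct (Hb t ltac:(lra)) as [Hw _].
        assert (HltR := Hlt t ltac:(lra)). unfold Rr in HltR.
        assert (H1 := pow2_ge_0 (w t - sin (x t))).
        assert (H4 := abs_lt_of_sq (wp t - cos (x t)) mu Hmu ltac:(lra)).
        assert (HD1 := weighted_z_le_excess k l (s t) (z t) Hk Hl). fold (D t) in HD1.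
        assert (HDt := HDc t ltac:(lra)).
        assert (Hkl : 0 <= k * l * z t ^ 2).
        { apply Rmult_le_pos; [nra|apply pow2_ge_0]. }
        assert (H0 : k * l * z t ^ 2 / w t <= (k + l - 1) * (D a * G) / del).
        { apply Rmult_le_compat; [easy| |nra|].
          - left. apply Rinv_0_lt_compat. lra.
          - apply Rinv_le_contravar; lra. }
        assert (H0' : 0 <= k * l * z t ^ 2 / w t) by (apply Rdiv_le_0_compat; lra).
        assert (H5 : del * (k * l * z t ^ 2 / w t) <= (k + l - 1) * (D a * G)).
        { apply (Rmult_le_compat_l del) in H0; [|lra].
          replace (del * ((k + l - 1) * (D a * G) / del)) with ((k + l - 1) * (D a * G)) in H0 by (field; lra).
          easy. }
        nra. }
    assert (0 <= D a * G) by (apply Rmult_le_pos; [apply HD0|lra]).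
    assert (Hca : c - a <= 4) by (unfold x in *; lra).
    assert (D a <= D a * G) by (assert (Hda := HD0 a); nra).
    unfold B.
    assert ((k + l - 1) * (D a * G) * (c - a) <= (k + l - 1) * (D a * G) * 4).
    { apply Rmult_le_compat_l; [apply Rmult_le_pos; lra|easy]. }
    assert (0 <= (k + l - 1) * (D a * G)) by (apply Rmult_le_pos; lra).
    lra. }
  assert (HDaB : D a * B < mu ^ 2 /\ D a * B < rho).
  { assert (D a * B <= d * B) by (apply Rmult_le_compat_r; lra). lra. }
  assert (Hmain : forall t, a <= t < T -> x t <= PI - e -> Rr t < mu ^ 2).
  { intros t0 Ht0 Hxt0.
    apply (real_induction a t0 (fun t => Rr t < mu ^ 2)); [| | |lra].
    - assert (H := HD0 a). nra.
    - intros c Hc Hall.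
      destruct (continuous_lt_locally Rr c (mu ^ 2)) as [eta [Heta Heta']].
      + assert (Hw' := cf_w F c ltac:(lra)).
        assert (Hwp' := cf_wp F c ltac:(lra)).
        apply (ex_derive_continuous Rr). unfold Rr, x. auto_derive.
        repeat split; eexists; eassumption.
      + apply Hall. lra.
      + exists eta. split; [easy|]. intros t Ht _. apply Heta'. apply Rabs_def1; lra.
    - intros c Hc Hall.
      destruct (Hbound c) as [_ H]; [lra| |exact Hall|lra]. unfold x in *. lra. }
  assert (HT : a + (PI - e - th) < T).
  { apply Rnot_le_lt. intros HT.
    destruct (cf_collapse F a del) as [t [Ht1 Ht2]]; [lra|lra|].
    assert (Hx : x ((t + T) / 2) <= PI - e) by (unfold x; lra).
    destruct (Hstep ((t + T) / 2) ltac:(lra) Hx) with (t := t) as [H _]; [|lra|lra].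
    intros y Hy. apply Hmain; [lra|]. unfold x in *. lra. }
  split; [easy|].
  intros t Ht.
  assert (Hx : x t <= PI - e) by (unfold x; lra).
  assert (HR := Hmain t ltac:(lra) Hx).
  destruct (Hbound t) as [HDt _]; [lra|easy| |].
  { intros y Hy. apply Hmain; [lra|]. unfold x in *. lra. }
  unfold Rr in HR. fold (x t).
  assert (H1 := pow2_ge_0 (w t - sin (x t))). assert (H2 := pow2_ge_0 (wp t - cos (x t))).
  assert (H3 := abs_lt_of_sq (w t - sin (x t)) mu Hmu ltac:(lra)).
  assert (H4 := abs_lt_of_sq (wp t - cos (x t)) mu Hmu ltac:(lra)).
  split; [|split].
  - apply Rabs_le. lra.
  - apply Rabs_le. lra.
  - fold (D t).
    assert (D a * G <= D a * B).
    { apply Rmult_le_compat_l; [apply HD0|]. unfold B. nra. }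
    lra.
Qed.

(** * Convergence of solutions that start at a small w *)

Lemma sin_lipschitz (x y : R) : Rabs (sin x - sin y) <= Rabs (x - y).
Proof.
  destruct (MVT_abs sin cos y x) as [c [Hc _]].
  { intros c _. apply derivable_pt_lim_sin. }
  rewrite Hc. assert (H := COS_bound c).
  assert (Rabs (cos c) <= 1) by (apply Rabs_le; lra).
  assert (H2 := Rabs_pos (x - y)). nra.
Qed.

Lemma cos_lipschitz (x y : R) : Rabs (cos x - cos y) <= Rabs (x - y).
Proof.
  rewrite <- !sin_shift. eapply Rle_trans; [apply sin_lipschitz|].
  right. rewrite <- Rabs_Ropp. f_equal. ring.
Qed.

(** The time at which w reaches om is at most a + 2 om, so the phase shift
    between w and the sine is of the order of om, which is chosen small before
    the initial size eta. *)
Lemma flow_convergence (k l C0 e rho : R) : 2 <= k -> 2 <= l ->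
  0 < e < PI / 2 -> 0 < rho ->
  exists eta, 0 < eta /\
  forall T w wp s z a, conformal_flow k l T w wp s z ->
    0 < a < T -> a <= eta -> w a <= eta -> 0 < wp a ->
    excess k l (s a) (z a) <= C0 ->
    PI - e < T /\
    forall t, e <= t <= PI - e ->
      Rabs (w t - sin t) <= rho /\ Rabs (wp t - cos t) <= rho /\
      excess k l (s t) (z t) <= rho.
Proof.
  intros Hk Hl He Hrho.
  assert (Hpi := PI_RGT_0).
  set (th := Rmin (PI / 6) (Rmin (e / 8) (rho / 6))).
  assert (Hth : 0 < th).
  { repeat apply Rmin_glb_lt; lra. }
  assert (Hth1 : th <= PI / 6) by apply Rmin_l.
  assert (Hth23 : th <= Rmin (e / 8) (rho / 6)) by apply Rmin_r.
  assert (Hth2 : th <= e / 8) by (eapply Rle_trans; [exact Hth23|apply Rmin_l]).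
  assert (Hth3 : th <= rho / 6) by (eapply Rle_trans; [exact Hth23|apply Rmin_r]).
  set (om := sin th).
  assert (Hom : 0 < om <= 1 / 2).
  { split; [apply sin_gt_0; lra|]. rewrite <- sin_PI6. apply sin_incr_1; lra. }
  assert (Homth : om < th) by (now apply sin_lt_x).
  assert (Hasin : asin om = th) by (apply asin_sin; lra).
  destruct (stability k l om (e / 2) (rho / 2) Hk Hl Hom) as [d [Hd Hstab]]; [lra|lra|].
  set (C := k * l * (1 + C0) * (((k + l) * (1 + C0)) ^ 2 + C0
      + (2 * (k + l) * ((k + l) * (1 + C0)) + (k + l) ^ 2 * (1 + C0) + 1) * C0)).
  (* From w <= eta to w = om, ln w gains more than C / d, so that the damping
     estimate brings the excess below d. *)
  set (eta := Rmin (om / 2) (om * exp (- (Rabs C / d + 1)))).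
  assert (Heta : 0 < eta).
  { apply Rmin_glb_lt; [lra|]. apply Rmult_lt_0_compat; [lra|apply exp_pos]. }
  assert (Heta1 : eta <= om / 2) by apply Rmin_l.
  assert (Heta2 : eta <= om * exp (- (Rabs C / d + 1))) by apply Rmin_r.
  exists eta. split; [easy|].
  intros T w wp s z a F Ha Haeta Hwa Hpa HC0.
  assert (Hwa0 := cf_pos F a Ha).
  destruct (damping k l T w wp s z Hk Hl F a om C0) as [b [Hb [Hba [Hwb [Hpb HDb]]]]]; try lra.
  fold C in HDb.
  assert (HL : Rabs C / d + 1 <= ln (om / w a)).
  { rewrite <- (ln_exp (Rabs C / d + 1)). apply ln_le; [apply exp_pos|].
    apply Rle_div_r; [easy|].
    apply Rle_trans with (exp (Rabs C / d + 1) * (om * exp (- (Rabs C / d + 1)))).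
    - apply Rmult_le_compat_l; [left; apply exp_pos|lra].
    - rewrite exp_Ropp. right. field. apply Rgt_not_eq, exp_pos. }
  assert (HDd : excess k l (s b) (z b) <= d).
  { apply Rnot_lt_le. intros Hgt.
    assert (HC : C <= Rabs C) by apply Rle_abs.
    assert (HCp : 0 <= Rabs C / d) by (apply Rdiv_le_0_compat; [apply Rabs_pos|easy]).
    assert (Hm : d * (Rabs C / d + 1) <= excess k l (s b) (z b) * ln (om / w a)).
    { apply Rmult_le_compat; lra. }
    replace (d * (Rabs C / d + 1)) with (Rabs C + d) in Hm by (field; lra). lra. }
  destruct (Hstab T w wp s z b F) as [HT Hconv]; try lra.
  rewrite Hasin in *.
  split; [lra|].
  intros t Ht.
  destruct (Hconv t) as [H1 [H2 H3]]; [lra|].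
  assert (Hsh : Rabs (t - b + th - t) <= rho / 2) by (apply Rabs_le; lra).
  assert (Hs := sin_lipschitz (t - b + th) t).
  assert (Hc := cos_lipschitz (t - b + th) t).
  split; [|split; [|lra]].
  - replace (w t - sin t) with ((w t - sin (t - b + th)) + (sin (t - b + th) - sin t)) by ring.
    eapply Rle_trans; [apply Rabs_triang|lra].
  - replace (wp t - cos t) with ((wp t - cos (t - b + th)) + (cos (t - b + th) - cos t)) by ring.
    eapply Rle_trans; [apply Rabs_triang|lra].
Qed.

(** * From warping functions to conformal variables *)

(** The second derivative of f that the second Einstein equation prescribes
    when the Einstein constant is k + l; exchanging the two factors gives that
    of h. *)
Definition warp_acc (k l f fp h hp : R) : R :=
  - (k + l) * f + (k - 1) * (1 - fp ^ 2) / f - l * fp * hp / h.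

Record warped_solution (k l T : R) (f fp h hp : R -> R) : Prop := {
  ws_f_pos : forall t, 0 < t < T -> 0 < f t;
  ws_h_pos : forall t, 0 < t < T -> 0 < h t;
  ws_f : forall t, 0 < t < T -> is_derive f t (fp t);
  ws_h : forall t, 0 < t < T -> is_derive h t (hp t);
  ws_fp : forall t, 0 < t < T ->
    is_derive fp t (warp_acc k l (f t) (fp t) (h t) (hp t));
  ws_hp : forall t, 0 < t < T ->
    is_derive hp t (warp_acc l k (h t) (hp t) (f t) (fp t))
}.

Arguments ws_f_pos {k l T f fp h hp} _ t _.
Arguments ws_h_pos {k l T f fp h hp} _ t _.
Arguments ws_f {k l T f fp h hp} _ t _.
Arguments ws_h {k l T f fp h hp} _ t _.
Arguments ws_fp {k l T f fp h hp} _ t _.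
Arguments ws_hp {k l T f fp h hp} _ t _.

(** The first Einstein equation; by the other two it only involves first
    derivatives. *)
Definition constraint (k l f fp h hp : R) : Prop :=
  - (k + l) = k * (warp_acc k l f fp h hp / f) + l * (warp_acc l k h hp f fp / h).

(** What both manifolds have in common at their second singular orbit: one of
    the two spheres collapses and the other one stays bounded. *)
Definition collapses_at (T : R) (f h : R -> R) : Prop :=
  (exists B, forall t, 0 < t < T -> f t <= B /\ h t <= B) /\
  forall a d, a < T -> 0 < d -> exists t, a < t < T /\ (f t < d \/ h t < d).

Definition cone_radius (k l : R) : R := sqrt ((k - 1) / (k + l - 1)).

Lemma cone_radius_sq (k l : R) : 2 <= k -> 2 <= l ->
  cone_radius k l ^ 2 = (k - 1) / (k + l - 1).
Proof.
  intros Hk Hl. unfold cone_radius. rewrite pow2_sqrt; [easy|].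
  apply Rdiv_le_0_compat; lra.
Qed.

Lemma cone_radius_bounds (k l : R) : 2 <= k -> 2 <= l -> 0 < cone_radius k l <= 1.
Proof.
  intros Hk Hl. unfold cone_radius. split.
  - apply sqrt_lt_R0. apply Rdiv_lt_0_compat; lra.
  - apply Rle_trans with (sqrt 1); [|now rewrite sqrt_1; right]. apply sqrt_le_1_alt.
    apply Rle_div_l; lra.
Qed.

Definition log_f (k l f : R) : R := ln (f / cone_radius k l).

Definition conf_w (k l f h : R) : R :=
  exp ((k * log_f k l f + l * log_f l k h) / (k + l)).

Definition conf_s (k l f h : R) : R := (log_f k l f - log_f l k h) / (k + l).

Definition conf_wp (k l f fp h hp : R) : R :=
  conf_w k l f h * ((k * (fp / f) + l * (hp / h)) / (k + l)).

Definition conf_z (k l f fp h hp : R) : R :=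
  conf_w k l f h * ((fp / f - hp / h) / (k + l)).

(** Together with [conf_h], the change of variables read backwards. *)
Lemma conf_f (k l f h : R) : 2 <= k -> 2 <= l -> 0 < f ->
  f = cone_radius k l * (conf_w k l f h * exp (l * conf_s k l f h)).
Proof.
  intros Hk Hl Hf. assert (HA := cone_radius_bounds k l Hk Hl).
  unfold conf_w. rewrite <- exp_plus.
  replace ((k * log_f k l f + l * log_f l k h) / (k + l) + l * conf_s k l f h) with (log_f k l f)
    by (unfold conf_s; field; lra).
  unfold log_f. rewrite exp_ln; [field; lra|]. apply Rdiv_lt_0_compat; lra.
Qed.

Lemma conf_h (k l f h : R) : 2 <= k -> 2 <= l -> 0 < h ->
  h = cone_radius l k * (conf_w k l f h * exp (- (k * conf_s k l f h))).
Proof.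
  intros Hk Hl Hf. assert (HA := cone_radius_bounds l k Hl Hk).
  unfold conf_w. rewrite <- exp_plus.
  replace ((k * log_f k l f + l * log_f l k h) / (k + l) + - (k * conf_s k l f h)) with (log_f l k h)
    by (unfold conf_s; field; lra).
  unfold log_f. rewrite exp_ln; [field; lra|]. apply Rdiv_lt_0_compat; lra.
Qed.

Lemma conf_w_pos (k l f h : R) : 0 < conf_w k l f h.
Proof. apply exp_pos. Qed.

Lemma exp_shape_f (k l f h : R) : 2 <= k -> 2 <= l -> 0 < f ->
  exp (- (2 * l * conf_s k l f h)) =
  (k - 1) / (k + l - 1) * (conf_w k l f h / f) ^ 2.
Proof.
  intros Hk Hl Hf. assert (HA := cone_radius_bounds k l Hk Hl).
  rewrite <- cone_radius_sq by easy.
  assert (Hw := conf_w_pos k l f h).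
  assert (H := conf_f k l f h Hk Hl Hf).
  replace (- (2 * l * conf_s k l f h)) with
    (- (l * conf_s k l f h) + - (l * conf_s k l f h)) by ring.
  rewrite exp_plus, exp_Ropp.
  assert (He := exp_pos (l * conf_s k l f h)).
  set (E := exp (l * conf_s k l f h)) in *. set (W := conf_w k l f h) in *.
  rewrite H. field. lra.
Qed.

Lemma exp_shape_h (k l f h : R) : 2 <= k -> 2 <= l -> 0 < h ->
  exp (2 * k * conf_s k l f h) =
  (l - 1) / (k + l - 1) * (conf_w k l f h / h) ^ 2.
Proof.
  intros Hk Hl Hf. assert (HA := cone_radius_bounds l k Hl Hk).
  replace (k + l - 1) with (l + k - 1) by ring.
  rewrite <- cone_radius_sq by easy.
  assert (Hw := conf_w_pos k l f h).
  assert (H := conf_h k l f h Hk Hl Hf).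
  replace (2 * k * conf_s k l f h) with
    (- - (k * conf_s k l f h) + - - (k * conf_s k l f h)) by ring.
  rewrite exp_plus, (exp_Ropp (- (k * conf_s k l f h))).
  assert (He := exp_pos (- (k * conf_s k l f h))).
  set (E := exp (- (k * conf_s k l f h))) in *. set (W := conf_w k l f h) in *.
  rewrite H. field. lra.
Qed.

Lemma log_f_derive (k l : R) (u : R -> R) (t du : R) :
  2 <= k -> 2 <= l -> 0 < u t -> is_derive u t du ->
  is_derive (fun t => log_f k l (u t)) t (du / u t).
Proof.
  intros Hk Hl Hu Hd. assert (HA := cone_radius_bounds k l Hk Hl).
  unfold log_f. auto_derive.
  - repeat split; [eexists; exact Hd|]. apply Rdiv_lt_0_compat; lra.
  - erewrite (is_derive_unique _ t) by exact Hd. field. lra.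
Qed.

Lemma log_f_le (k l u B : R) : 2 <= k -> 2 <= l -> 0 < u -> u <= B ->
  log_f k l u <= ln (B / cone_radius k l).
Proof.
  intros Hk Hl Hu HB. assert (HA := cone_radius_bounds k l Hk Hl).
  unfold log_f. apply ln_le; [apply Rdiv_lt_0_compat; lra|].
  apply Rmult_le_compat_r; [left; apply Rinv_0_lt_compat; lra|easy].
Qed.

Lemma log_derivative_combination (f fp h hp : R -> R) (t x y a1 a2 : R) :
  0 < f t -> 0 < h t ->
  is_derive f t (fp t) -> is_derive h t (hp t) ->
  is_derive fp t a1 -> is_derive hp t a2 ->
  is_derive (fun t => x * (fp t / f t) + y * (hp t / h t)) t
    (x * (a1 / f t - (fp t / f t) ^ 2) + y * (a2 / h t - (hp t / h t) ^ 2)).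
Proof.
  intros Hf Hh H1 H2 H3 H4. auto_derive.
  - repeat split; try lra; eexists; eassumption.
  - erewrite !(is_derive_unique _ t) by eassumption. field. lra.
Qed.

Lemma exp_combination_derive (k l : R) (u v : R -> R) (t du dv : R) :
  0 < k + l -> is_derive u t du -> is_derive v t dv ->
  is_derive (fun t => exp ((k * u t + l * v t) / (k + l))) t
    (exp ((k * u t + l * v t) / (k + l)) * ((k * du + l * dv) / (k + l))).
Proof.
  intros Hkl H1 H2. auto_derive.
  - repeat split; eexists; eassumption.
  - erewrite !(is_derive_unique _ t) by eassumption. unfold Rdiv. ring.
Qed.

Lemma product_quotient_derive (u v : R -> R) (t du dv c : R) :
  is_derive u t du -> is_derive v t dv ->
  is_derive (fun t => u t * (v t / c)) t (du * (v t / c) + u t * (dv / c)).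
Proof.
  intros H1 H2. auto_derive.
  - repeat split; eexists; eassumption.
  - erewrite !(is_derive_unique _ t) by eassumption. unfold Rdiv. ring.
Qed.

(** The equations are identities between rational functions once the
    exponentials are written with [exp_shape_f] and [exp_shape_h]; the
    equation for w' and the relation between w, w' and the excess also use the
    constraint. *)
Lemma conformal_flow_of_warped (k l T : R) (f fp h hp : R -> R) :
  2 <= k -> 2 <= l ->
  warped_solution k l T f fp h hp ->
  (forall t, 0 < t < T -> constraint k l (f t) (fp t) (h t) (hp t)) ->
  0 < T -> collapses_at T f h ->
  conformal_flow k l T
    (fun t => conf_w k l (f t) (h t)) (fun t => conf_wp k l (f t) (fp t) (h t) (hp t))
    (fun t => conf_s k l (f t) (h t)) (fun t => conf_z k l (f t) (fp t) (h t) (hp t)).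
Proof.
  intros Hk Hl S HC HT0 [[B HB] Hend].
  assert (Hw' : forall t, 0 < t < T -> is_derive (fun t => conf_w k l (f t) (h t)) t
     (conf_wp k l (f t) (fp t) (h t) (hp t))).
  { intros t Ht.
    assert (Hf := ws_f_pos S t Ht). assert (Hh := ws_h_pos S t Ht).
    assert (H1 := log_f_derive k l f t _ Hk Hl Hf (ws_f S t Ht)).
    assert (H2 := log_f_derive l k h t _ Hl Hk Hh (ws_h S t Ht)).
    assert (Hc := exp_combination_derive k l _ _ t _ _ ltac:(lra) H1 H2). cbv beta in Hc.
    unfold conf_wp, conf_w. exact Hc. }
  constructor.
  - intros. apply conf_w_pos.
  - exact Hw'.
  - intros t Ht.
    assert (Hw := Hw' t Ht).
    assert (Hf := ws_f_pos S t Ht). assert (Hh := ws_h_pos S t Ht).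
    assert (H1 := ws_f S t Ht). assert (H2 := ws_h S t Ht).
    assert (H3 := ws_fp S t Ht). assert (H4 := ws_hp S t Ht).
    assert (HCt := HC t Ht). unfold constraint in HCt.
    assert (HW := conf_w_pos k l (f t) (h t)).
    set (a1 := warp_acc k l (f t) (fp t) (h t) (hp t)) in *.
    set (a2 := warp_acc l k (h t) (hp t) (f t) (fp t)) in *.
    assert (Hd := log_derivative_combination f fp h hp t k l _ _ Hf Hh H1 H2 H3 H4).
    assert (Hp := product_quotient_derive _ _ t _ _ (k + l) Hw Hd). cbv beta in Hp.
    evar_last.
    + exact Hp.
    + assert (HCt' : k * (a1 / f t) = - (k + l) - l * (a2 / h t)) by lra.
      replace (k * (a1 / f t - (fp t / f t) ^ 2) + l * (a2 / h t - (hp t / h t) ^ 2))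
        with (- (k + l) - k * (fp t / f t) ^ 2 - l * (hp t / h t) ^ 2) by lra.
      unfold conf_wp, conf_z. field. repeat split; lra.
  - intros t Ht.
    assert (Hf := ws_f_pos S t Ht). assert (Hh := ws_h_pos S t Ht).
    assert (H1 := log_f_derive k l f t _ Hk Hl Hf (ws_f S t Ht)).
    assert (H2 := log_f_derive l k h t _ Hl Hk Hh (ws_h S t Ht)).
    assert (HW := conf_w_pos k l (f t) (h t)).
    assert (Hd := is_derive_scal _ t (/ (k + l)) _ (is_derive_minus _ _ t _ _ H1 H2)).
    evar_last.
    + apply (is_derive_ext _ (fun t => conf_s k l (f t) (h t)) t _) in Hd; [exact Hd|].
      intros x. apply Rmult_comm.
    + unfold minus, plus, opp; simpl. unfold scal; simpl; unfold mult; simpl.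
      unfold conf_z. field. repeat split; lra.
  - intros t Ht.
    assert (Hw := Hw' t Ht).
    assert (Hf := ws_f_pos S t Ht). assert (Hh := ws_h_pos S t Ht).
    assert (H1 := ws_f S t Ht). assert (H2 := ws_h S t Ht).
    assert (H3 := ws_fp S t Ht). assert (H4 := ws_hp S t Ht).
    assert (HW := conf_w_pos k l (f t) (h t)).
    assert (Hd := log_derivative_combination f fp h hp t 1 (-1) _ _ Hf Hh H1 H2 H3 H4).
    apply (is_derive_ext _ (fun t => fp t / f t - hp t / h t)) in Hd; [|intros x; apply Rminus_diag_uniq; simpl; ring].
    assert (Hp := product_quotient_derive _ _ t _ _ (k + l) Hw Hd). cbv beta in Hp.
    evar_last.
    + exact Hp.
    + unfold shape_force. rewrite exp_shape_f, exp_shape_h by easy.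
      unfold conf_wp, conf_z, warp_acc. field. repeat split; lra.
  - intros t Ht.
    assert (Hf := ws_f_pos S t Ht). assert (Hh := ws_h_pos S t Ht).
    assert (HW := conf_w_pos k l (f t) (h t)).
    assert (HCt := HC t Ht).
    unfold excess, shape_excess. rewrite exp_shape_f, exp_shape_h by easy.
    unfold constraint, warp_acc in HCt.
    set (W := conf_w k l (f t) (h t)) in *.
    assert (Hsum : (k + l - 1) * (k * ((k - 1) / (k + l - 1) * (/ f t) ^ 2) + l * ((l - 1) / (k + l - 1) * (/ h t) ^ 2))
      = (k + l) * (k + l - 1) + (k * (fp t / f t) + l * (hp t / h t)) ^ 2
        - k * (fp t / f t) ^ 2 - l * (hp t / h t) ^ 2).
    { apply Rminus_diag_eq in HCt. apply Rminus_diag_uniq.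
      rewrite <- Ropp_0, <- HCt. field. repeat split; lra. }
    assert (Hsum' : k * ((k - 1) / (k + l - 1) * (/ f t) ^ 2) + l * ((l - 1) / (k + l - 1) * (/ h t) ^ 2)
      = ((k + l) * (k + l - 1) + (k * (fp t / f t) + l * (hp t / h t)) ^ 2
        - k * (fp t / f t) ^ 2 - l * (hp t / h t) ^ 2) / (k + l - 1)).
    { rewrite <- Hsum. field. repeat split; lra. }
    replace (k * ((k - 1) / (k + l - 1) * (W / f t) ^ 2) + l * ((l - 1) / (k + l - 1) * (W / h t) ^ 2))
      with (W ^ 2 * (k * ((k - 1) / (k + l - 1) * (/ f t) ^ 2) + l * ((l - 1) / (k + l - 1) * (/ h t) ^ 2)))
      by (field; repeat split; lra).
    rewrite Hsum'. unfold conf_wp, conf_z. fold W. field. repeat split; lra.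
  - intros a d HaT Hd.
    set (b1 := Rabs (ln (B / cone_radius k l))).
    set (b2 := Rabs (ln (B / cone_radius l k))).
    (* One of the logarithms is at most - m, the other one at most b1 or b2. *)
    set (m := (k + l) * (Rabs (ln d) + b1 + b2 + 1)).
    assert (HA1 := cone_radius_bounds k l Hk Hl).
    assert (HA2 := cone_radius_bounds l k Hl Hk).
    destruct (Hend (Rmax 0 a) (exp (- m) * Rmin (cone_radius k l) (cone_radius l k))) as [t [Ht Hsmall]].
    { apply Rmax_lub_lt; lra. }
    { apply Rmult_lt_0_compat; [apply exp_pos|apply Rmin_glb_lt; lra]. }
    assert (Hm1 := Rmax_l 0 a). assert (Hm2 := Rmax_r 0 a).
    exists t. split; [lra|].
    assert (Hf := ws_f_pos S t ltac:(lra)). assert (Hh := ws_h_pos S t ltac:(lra)).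
    destruct (HB t ltac:(lra)) as [HBf HBh].
    assert (L1 := log_f_le k l (f t) B Hk Hl Hf HBf).
    assert (L2 := log_f_le l k (h t) B Hl Hk Hh HBh).
    assert (Hb1 : ln (B / cone_radius k l) <= b1) by apply Rle_abs.
    assert (Hb2 : ln (B / cone_radius l k) <= b2) by apply Rle_abs.
    assert (Hb10 : 0 <= b1) by apply Rabs_pos. assert (Hb20 : 0 <= b2) by apply Rabs_pos.
    assert (Hld : - ln d <= Rabs (ln d)) by (rewrite <- Rabs_Ropp; apply Rle_abs).
    assert (Hld0 := Rabs_pos (ln d)).
    unfold conf_w. rewrite <- (exp_ln d) by easy. apply exp_increasing.
    apply Rlt_div_l; [lra|].
    assert (Hcase : forall x y u, 2 <= x -> 2 <= y -> x + y = k + l -> 0 < u ->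
      u < exp (- m) * Rmin (cone_radius k l) (cone_radius l k) ->
      Rmin (cone_radius k l) (cone_radius l k) <= cone_radius x y ->
      x * log_f x y u <= - m).
    { intros x y u Hx Hy Hxy Hu Hum Hmin. assert (HAx := cone_radius_bounds x y Hx Hy).
      assert (Hmin0 : 0 < Rmin (cone_radius k l) (cone_radius l k)) by (apply Rmin_glb_lt; lra).
      assert (log_f x y u <= - m).
      { unfold log_f. rewrite <- (ln_exp (- m)). apply ln_le; [apply Rdiv_lt_0_compat; lra|].
        apply Rle_div_l; [lra|]. assert (He := exp_pos (- m)). nra. }
      assert (0 <= m) by (apply Rmult_le_pos; lra). nra. }
    assert (Hm : m = (k + l) * Rabs (ln d) + k * b1 + l * b1 + k * b2 + l * b2 + k + l) by (unfold m; ring).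
    assert (0 <= k * b1 /\ 0 <= l * b1 /\ 0 <= k * b2 /\ 0 <= l * b2) by (repeat split; apply Rmult_le_pos; lra).
    assert ((k + l) * - ln d <= (k + l) * Rabs (ln d)) by (apply Rmult_le_compat_l; lra).
    destruct Hsmall as [Hs|Hs].
    + assert (H1 := Hcase k l (f t) Hk Hl eq_refl Hf Hs (Rmin_l _ _)).
      assert (l * log_f l k (h t) <= l * b2) by (apply Rmult_le_compat_l; lra).
      lra.
    + assert (H1 := Hcase l k (h t) Hl Hk (Rplus_comm _ _) Hh Hs (Rmin_r _ _)).
      assert (k * log_f k l (f t) <= k * b1) by (apply Rmult_le_compat_l; lra).
      lra.
Qed.

(** * The initial layer near the first singular orbit *)

(** A barrier is not touched from above at a point where the derivative would
    point upwards. *)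
Lemma above_until (u : R -> R) (a c y du : R) : a < c ->
  (forall t, a < t < c -> y < u t) -> is_derive u c du ->
  (u c = y -> 0 < du) -> y < u c.
Proof.
  intros Hac Habove Hd Hpos.
  assert (Hcont := continuous_of_derive u c du Hd).
  destruct (Rtotal_order (u c) y) as [Hlt|[Heq|Hgt]]; [| |easy]; exfalso.
  - destruct (continuous_lt_locally u c y Hcont Hlt) as [d [Hd0 Hd1]].
    assert (Hm1 := Rmax_l a (c - d)). assert (Hm2 := Rmax_r a (c - d)).
    assert (Hm3 : Rmax a (c - d) < c) by (apply Rmax_lub_lt; lra).
    set (t := (Rmax a (c - d) + c) / 2).
    assert (H1 := Hd1 t ltac:(unfold t; apply Rabs_def1; lra)).
    assert (H2 := Habove t ltac:(unfold t; lra)). lra.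
  - specialize (Hpos Heq).
    apply is_derive_Reals in Hd. destruct (Hd du Hpos) as [d Hd'].
    assert (Hd0 := cond_pos d).
    assert (Hm1 := Rmax_l a (c - d)). assert (Hm2 := Rmax_r a (c - d)).
    assert (Hm3 : Rmax a (c - d) < c) by (apply Rmax_lub_lt; lra).
    set (t := (Rmax a (c - d) + c) / 2).
    assert (Ht : a < t < c /\ c - d < t) by (unfold t; lra).
    assert (H1 := Habove t ltac:(lra)).
    specialize (Hd' (t - c) ltac:(lra) ltac:(apply Rabs_def1; lra)).
    replace (c + (t - c)) with t in Hd' by ring.
    apply Rabs_def2 in Hd'. destruct Hd' as [_ Hd'].
    assert (Hneg : (u t - u c) / (t - c) <= 0).
    { replace ((u t - u c) / (t - c)) with (- ((u t - u c) / (c - t))) by (field; lra).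
      assert (0 <= (u t - u c) / (c - t)) by (apply Rdiv_le_0_compat; lra). lra. }
    lra.
Qed.

Lemma below_until (u : R -> R) (a c y du : R) : a < c ->
  (forall t, a < t < c -> u t < y) -> is_derive u c du ->
  (u c = y -> du < 0) -> u c < y.
Proof.
  intros Hac Hbelow Hd Hneg.
  assert (H := above_until (fun t => - u t) a c (- y) (- du) Hac).
  assert (- y < - u c); [|lra].
  apply H.
  - intros t Ht. assert (H1 := Hbelow t Ht). lra.
  - apply (is_derive_opp u). exact Hd.
  - intros Heq. assert (du < 0); [apply Hneg|]; lra.
Qed.

Definition right_limit (u : R -> R) (y : R) : Prop :=
  filterlim u (at_right 0) (locally y).

Lemma right_limit_lt (u : R -> R) (y y' : R) : right_limit u y -> y < y' ->
  exists d, 0 < d /\ forall t, 0 < t < d -> u t < y'.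
Proof.
  intros Hu Hy.
  assert (He : 0 < y' - y) by lra.
  destruct (proj1 (filterlim_locally u y) Hu (mkposreal _ He)) as [d Hd].
  exists d. split; [apply cond_pos|].
  intros t Ht. specialize (Hd t).
  assert (H : Rabs (u t - y) < y' - y).
  { apply Hd; [|lra]. change (Rabs (t - 0) < d). rewrite Rminus_0_r, Rabs_right; lra. }
  apply Rabs_def2 in H. lra.
Qed.

Lemma right_limit_opp (u : R -> R) (y : R) :
  right_limit u y -> right_limit (fun t => - u t) (- y).
Proof.
  intros Hu. eapply filterlim_comp; [exact Hu|]. apply (filterlim_opp y).
Qed.

Lemma right_limit_gt (u : R -> R) (y y' : R) : right_limit u y -> y' < y ->
  exists d, 0 < d /\ forall t, 0 < t < d -> y' < u t.
Proof.
  intros Hu Hy.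
  destruct (right_limit_lt _ _ (- y') (right_limit_opp u y Hu)) as [d [Hd Hd']]; [lra|].
  exists d. split; [easy|]. intros t Ht. specialize (Hd' t Ht). lra.
Qed.

(** The mean value inequality on (0, c] when the value at 0 is only known as a
    limit. *)
Lemma growth_le (u du : R -> R) (y m c : R) : 0 < c ->
  (forall t, 0 < t <= c -> is_derive u t (du t)) ->
  (forall t, 0 < t < c -> du t <= m) -> right_limit u y ->
  u c <= y + m * c.
Proof.
  intros Hc Hu Hdu Hlim. apply Rnot_lt_le. intros Hgt.
  set (eps := (u c - (y + m * c)) / 2).
  destruct (right_limit_lt u y (y + eps) Hlim) as [d1 [Hd1 Hd1']]; [unfold eps; lra|].
  set (d2 := eps / (Rabs m + 1)).
  assert (Hm := Rle_abs (- m)). rewrite Rabs_Ropp in Hm.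
  assert (Hm0 := Rabs_pos m).
  assert (Hd2 : 0 < d2) by (unfold d2, eps; apply Rdiv_lt_0_compat; lra).
  set (a := Rmin c (Rmin d1 d2) / 2).
  assert (Hmin : 0 < Rmin c (Rmin d1 d2)) by (repeat apply Rmin_glb_lt; lra).
  assert (H1 := Rmin_l c (Rmin d1 d2)). assert (H2 := Rmin_r c (Rmin d1 d2)).
  assert (H3 := Rmin_l d1 d2). assert (H4 := Rmin_r d1 d2).
  assert (Ha : 0 < a /\ a < c /\ a < d1 /\ a < d2) by (unfold a; lra).
  assert (Hua := Hd1' a ltac:(lra)).
  assert (H : m * a - u a <= m * c - u c).
  { apply (le_of_derive_nonneg (fun t => m * t - u t) (fun t => m - du t)); [lra| |].
    - intros t Ht. assert (Hd := Hu t ltac:(lra)). auto_derive.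
      + eexists; exact Hd.
      + erewrite (is_derive_unique _ t) by exact Hd. ring.
    - intros t Ht. assert (Hd := Hdu t ltac:(lra)). lra. }
  assert (Hma : - m * a <= eps).
  { apply Rle_trans with ((Rabs m + 1) * d2); [|right; unfold d2; field; lra]. nra. }
  unfold eps in *. lra.
Qed.

Lemma growth_ge (u du : R -> R) (y m c : R) : 0 < c ->
  (forall t, 0 < t <= c -> is_derive u t (du t)) ->
  (forall t, 0 < t < c -> m <= du t) -> right_limit u y ->
  y + m * c <= u c.
Proof.
  intros Hc Hu Hdu Hlim.
  assert (- u c <= - y + (- m) * c); [|lra].
  apply (growth_le (fun t => - u t) (fun t => - du t)); [easy| | |].
  - intros t Ht. apply (is_derive_opp u). now apply Hu.
  - intros t Ht. specialize (Hdu t Ht). lra.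
  - now apply right_limit_opp.
Qed.

(** For times up to a, f is comparable with t and h with hb, and f/h is at most
    1/(4n).  On the faces of the box 1/2 < f' < 2, - 1/2 < h' < 2 the second
    derivatives then point into the box, with the sign of the curvature terms
    (k-1)(1-f'^2)/f and (l-1)(1-h'^2)/h, because each mixed term either has the
    same sign or is dominated.  So (f', h'), which starts at (1, 0), cannot
    leave the box. *)
Lemma initial_layer (k l T hb : R) (f fp h hp : R -> R) :
  2 <= k -> 2 <= l -> 0 < T -> 0 < hb < 1 / (4 * (k + l)) ->
  warped_solution k l T f fp h hp -> collapses_at T f h ->
  right_limit f 0 -> right_limit fp 1 -> right_limit h hb -> right_limit hp 0 ->
  let a := hb / (16 * (k + l)) in
  a < T /\ a / 2 <= f a <= 2 * a /\ hb / 2 <= h a <= 2 * hb /\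
  1 / 2 < fp a < 2 /\ - (1 / 2) < hp a < 2.
Proof.
  intros Hk Hl HT Hhb S [_ Hend] Lf Lfp Lh Lhp a.
  set (n := k + l) in *.
  assert (Hn : 4 <= n) by (unfold n; lra).
  assert (Hna : 16 * n * a = hb) by (unfold a; field; lra).
  assert (Ha : 0 < a) by (unfold a; apply Rdiv_lt_0_compat; lra).
  assert (Hahb : 64 * a <= hb) by nra.
  assert (Hnhb : 4 * n * hb < 1).
  { destruct Hhb as [_ H]. apply (Rmult_lt_compat_l (4 * n)) in H; [|lra].
    replace (4 * n * (1 / (4 * n))) with 1 in H by (field; lra). lra. }
  set (box := fun t => 1 / 2 < fp t < 2 /\ - (1 / 2) < hp t < 2).
  assert (Hgrow : forall c, 0 < c < T -> c <= a -> (forall t, 0 < t < c -> box t) ->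
    c / 2 <= f c <= 2 * c /\ hb / 2 <= h c <= 2 * hb).
  { intros c Hc Hca Hbox.
    assert (Df : forall t, 0 < t <= c -> is_derive f t (fp t)).
    { intros t Ht. apply (ws_f S). lra. }
    assert (Dh : forall t, 0 < t <= c -> is_derive h t (hp t)).
    { intros t Ht. apply (ws_h S). lra. }
    assert (G1 := growth_le f fp 0 2 c ltac:(lra) Df ltac:(intros t Ht; destruct (Hbox t Ht); lra) Lf).
    assert (G2 := growth_ge f fp 0 (1 / 2) c ltac:(lra) Df ltac:(intros t Ht; destruct (Hbox t Ht); lra) Lf).
    assert (G3 := growth_le h hp hb 2 c ltac:(lra) Dh ltac:(intros t Ht; destruct (Hbox t Ht); lra) Lh).
    assert (G4 := growth_ge h hp hb (- (1 / 2)) c ltac:(lra) Dh ltac:(intros t Ht; destruct (Hbox t Ht); lra) Lh).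
    lra. }
  assert (Hbox : forall t, 0 < t < T -> t <= a -> box t).
  { intros t0 Ht0 Hta.
    enough (H : forall t, 0 <= t <= t0 -> 0 < t -> box t) by (apply H; lra).
    apply (real_induction 0 t0 (fun t => 0 < t -> box t)).
    - intros H. lra.
    - intros c Hc Hall.
      destruct (Rle_lt_or_eq_dec 0 c) as [Hc0|Hc0]; [lra| |].
      + destruct (Hall c ltac:(lra) Hc0) as [B1 B2].
        assert (C1 := continuous_of_derive _ _ _ (ws_fp S c ltac:(lra))).
        assert (C2 := continuous_of_derive _ _ _ (ws_hp S c ltac:(lra))).
        destruct (continuous_lt_locally fp c 2 C1) as [d1 [Hd1 E1]]; [lra|].
        destruct (continuous_lt_locally (fun t => - fp t) c (- (1 / 2)) (continuous_opp fp c C1)) as [d2 [Hd2 E2]]; [lra|].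
        destruct (continuous_lt_locally hp c 2 C2) as [d3 [Hd3 E3]]; [lra|].
        destruct (continuous_lt_locally (fun t => - hp t) c (1 / 2) (continuous_opp hp c C2)) as [d4 [Hd4 E4]]; [lra|].
        exists (Rmin (Rmin d1 d2) (Rmin d3 d4)). split; [repeat apply Rmin_glb_lt; lra|].
        intros t Ht _ _.
        assert (M1 := Rmin_l (Rmin d1 d2) (Rmin d3 d4)).
        assert (M2 := Rmin_r (Rmin d1 d2) (Rmin d3 d4)).
        assert (M3 := Rmin_l d1 d2). assert (M4 := Rmin_r d1 d2).
        assert (M5 := Rmin_l d3 d4). assert (M6 := Rmin_r d3 d4).
        assert (F1 := E1 t ltac:(apply Rabs_def1; lra)).
        assert (F2 := E2 t ltac:(apply Rabs_def1; lra)).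
        assert (F3 := E3 t ltac:(apply Rabs_def1; lra)).
        assert (F4 := E4 t ltac:(apply Rabs_def1; lra)).
        unfold box. lra.
      + destruct (right_limit_lt fp 1 2 Lfp) as [d1 [Hd1 E1]]; [lra|].
        destruct (right_limit_gt fp 1 (1 / 2) Lfp) as [d2 [Hd2 E2]]; [lra|].
        destruct (right_limit_lt hp 0 2 Lhp) as [d3 [Hd3 E3]]; [lra|].
        destruct (right_limit_gt hp 0 (- (1 / 2)) Lhp) as [d4 [Hd4 E4]]; [lra|].
        exists (Rmin (Rmin d1 d2) (Rmin d3 d4)). split; [repeat apply Rmin_glb_lt; lra|].
        intros t Ht _ _.
        assert (M1 := Rmin_l (Rmin d1 d2) (Rmin d3 d4)).
        assert (M2 := Rmin_r (Rmin d1 d2) (Rmin d3 d4)).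
        assert (M3 := Rmin_l d1 d2). assert (M4 := Rmin_r d1 d2).
        assert (M5 := Rmin_l d3 d4). assert (M6 := Rmin_r d3 d4).
        assert (F1 := E1 t ltac:(lra)). assert (F2 := E2 t ltac:(lra)).
        assert (F3 := E3 t ltac:(lra)). assert (F4 := E4 t ltac:(lra)).
        unfold box. lra.
    - intros c Hc Hall Hc0.
      assert (Hb : forall t, 0 < t < c -> box t) by (intros t Ht; apply Hall; lra).
      destruct (Hgrow c ltac:(lra) ltac:(lra) Hb) as [Gf Gh].
      assert (D1 := ws_fp S c ltac:(lra)).
      assert (D2 := ws_hp S c ltac:(lra)).
      assert (Hf0 : 0 < f c) by lra. assert (Hh0 : 0 < h c) by lra.
      assert (Nf : n * f c ^ 2 < 1 / 8).
      { assert (f c <= hb / 32) by lra. assert (f c ^ 2 <= (hb / 32) ^ 2) by nra.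
        assert (n * f c ^ 2 <= n * (hb / 32) ^ 2) by (apply Rmult_le_compat_l; lra). nra. }
      assert (Nh : n * h c ^ 2 < 1 / 2).
      { assert (h c ^ 2 <= (2 * hb) ^ 2) by nra.
        assert (n * h c ^ 2 <= n * (2 * hb) ^ 2) by (apply Rmult_le_compat_l; lra). nra. }
      assert (Nfh : 4 * n * f c <= h c) by nra.
      assert (Af : f c * warp_acc k l (f c) (fp c) (h c) (hp c) =
        - n * f c ^ 2 + (k - 1) * (1 - fp c ^ 2) - l * fp c * hp c * (f c / h c)).
      { unfold warp_acc, n. field. lra. }
      assert (Ah : warp_acc l k (h c) (hp c) (f c) (fp c) * h c =
        - n * h c ^ 2 + (l - 1) * (1 - hp c ^ 2) - k * hp c * fp c * (h c / f c)).
      { unfold warp_acc, n. field. lra. }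
      assert (Q1 : 0 < f c / h c) by (apply Rdiv_lt_0_compat; lra).
      assert (Q2 : 4 * n * (f c / h c) <= 1).
      { replace (4 * n * (f c / h c)) with ((4 * n * f c) / h c) by (field; lra).
        apply Rle_div_l; lra. }
      assert (Q2' : 4 * l * (f c / h c) <= 1) by (unfold n in *; nra).
      assert (Q3 : 0 < h c / f c) by (apply Rdiv_lt_0_compat; lra).
      set (q := f c / h c) in *. set (r := h c / f c) in *.
      set (af := warp_acc k l (f c) (fp c) (h c) (hp c)) in *.
      set (ah := warp_acc l k (h c) (hp c) (f c) (fp c)) in *.
      assert (Hfp_ge : 1 / 2 <= fp c).
      { apply Rnot_lt_le. intros Hlt.
        assert (H := above_until fp 0 c (1 / 2) af Hc0 ltac:(intros t Ht; destruct (Hb t Ht); lra) D1 ltac:(intro; lra)). lra. }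
      assert (Hfp_le : fp c <= 2).
      { apply Rnot_lt_le. intros Hlt.
        assert (H := below_until fp 0 c 2 af Hc0 ltac:(intros t Ht; destruct (Hb t Ht); lra) D1 ltac:(intro; lra)). lra. }
      assert (Hhp_ge : - (1 / 2) <= hp c).
      { apply Rnot_lt_le. intros Hlt.
        assert (H := above_until hp 0 c (- (1 / 2)) ah Hc0 ltac:(intros t Ht; destruct (Hb t Ht); lra) D2 ltac:(intro; lra)). lra. }
      assert (Hhp_le : hp c <= 2).
      { apply Rnot_lt_le. intros Hlt.
        assert (H := below_until hp 0 c 2 ah Hc0 ltac:(intros t Ht; destruct (Hb t Ht); lra) D2 ltac:(intro; lra)). lra. }
      assert (Hlq : 0 < l * q) by nra.
      assert (Hkr : 0 < k * r) by nra.
      assert (Hnf0 : 0 < n * f c ^ 2) by nra.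
      assert (Hnh0 : 0 < n * h c ^ 2) by nra.
      split; split.
      + apply (above_until fp 0 c (1 / 2) af Hc0); [intros t Ht; destruct (Hb t Ht); lra|easy|].
        intros Heq. rewrite Heq in Af.
        assert (l * q * hp c <= l * q * 2) by (apply Rmult_le_compat_l; lra).
        assert (0 < f c * af) by lra. nra.
      + apply (below_until fp 0 c 2 af Hc0); [intros t Ht; destruct (Hb t Ht); lra|easy|].
        intros Heq. rewrite Heq in Af.
        assert (l * q * - (1 / 2) <= l * q * hp c) by (apply Rmult_le_compat_l; lra).
        assert (f c * af < 0) by lra. nra.
      + apply (above_until hp 0 c (- (1 / 2)) ah Hc0); [intros t Ht; destruct (Hb t Ht); lra|easy|].
        intros Heq. rewrite Heq in Ah.
        assert (0 <= k * r * fp c) by (apply Rmult_le_pos; lra).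
        assert (0 < ah * h c) by lra. nra.
      + apply (below_until hp 0 c 2 ah Hc0); [intros t Ht; destruct (Hb t Ht); lra|easy|].
        intros Heq. rewrite Heq in Ah.
        assert (0 <= k * r * fp c) by (apply Rmult_le_pos; lra).
        assert (ah * h c < 0) by lra. nra. }
  assert (HaT : a < T).
  { apply Rnot_le_lt. intros Hle.
    destruct (Hend (T / 2) (Rmin (T / 4) (hb / 2))) as [t [Ht Hsm]]; [lra|apply Rmin_glb_lt; lra|].
    assert (M1 := Rmin_l (T / 4) (hb / 2)). assert (M2 := Rmin_r (T / 4) (hb / 2)).
    destruct (Hgrow t) as [G1 G2]; [lra|lra| |lra].
    intros x Hx. apply Hbox; lra. }
  split; [easy|].
  destruct (Hgrow a) as [G1 G2]; [lra|lra|intros x Hx; apply Hbox; lra|].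
  destruct (Hbox a) as [B1 B2]; lra.
Qed.

(** * Convergence of warping functions and first derivatives *)

Lemma conf_w_le (k l f h m : R) : 2 <= k -> 2 <= l -> 0 < f -> 0 < h ->
  f <= m * cone_radius k l -> h <= m * cone_radius l k -> conf_w k l f h <= m.
Proof.
  intros Hk Hl Hf Hh Hfm Hhm.
  assert (HA1 := cone_radius_bounds k l Hk Hl).
  assert (HA2 := cone_radius_bounds l k Hl Hk).
  assert (Hm : 0 < m) by nra.
  assert (L1 := log_f_le k l f _ Hk Hl Hf Hfm).
  assert (L2 := log_f_le l k h _ Hl Hk Hh Hhm).
  replace (m * cone_radius k l / cone_radius k l) with m in L1 by (field; lra).
  replace (m * cone_radius l k / cone_radius l k) with m in L2 by (field; lra).
  unfold conf_w. rewrite <- (exp_ln m) by easy.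
  assert (Hle : (k * log_f k l f + l * log_f l k h) / (k + l) <= ln m).
  { apply div_le; [lra|]. nra. }
  destruct Hle as [Hlt|Heq]; [left; now apply exp_increasing|right; now rewrite Heq].
Qed.

Lemma excess_conf_le (k l f fp h hp : R) : 2 <= k -> 2 <= l -> 0 < f -> 0 < h ->
  excess k l (conf_s k l f h) (conf_z k l f fp h hp) <=
  (conf_w k l f h / f) ^ 2 + (conf_w k l f h / h) ^ 2 + k * l * conf_z k l f fp h hp ^ 2.
Proof.
  intros Hk Hl Hf Hh. unfold excess, shape_excess.
  rewrite exp_shape_f, exp_shape_h by easy.
  set (W := conf_w k l f h). set (Z := conf_z k l f fp h hp).
  assert (H1 := pow2_ge_0 (W / f)). assert (H2 := pow2_ge_0 (W / h)).
  assert (H3 := pow2_ge_0 Z).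
  assert (Hz : k * l / (k + l - 1) * Z ^ 2 <= k * l * Z ^ 2).
  { apply Rmult_le_compat_r; [easy|]. apply div_le; [lra|].
    assert (0 <= k * l) by nra. nra. }
  assert (E1 : (k - 1) / (k + l - 1) <= 1) by (apply div_le; lra).
  assert (E2 : (l - 1) / (k + l - 1) <= 1) by (apply div_le; lra).
  assert (E1' : (k - 1) / (k + l - 1) * (W / f) ^ 2 <= (W / f) ^ 2) by nra.
  assert (E2' : (l - 1) / (k + l - 1) * (W / h) ^ 2 <= (W / h) ^ 2) by nra.
  assert (Hs : (k * ((k - 1) / (k + l - 1) * (W / f) ^ 2) + l * ((l - 1) / (k + l - 1) * (W / h) ^ 2)) / (k + l)
     <= (W / f) ^ 2 + (W / h) ^ 2).
  { apply div_le; [lra|]. nra. }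
  lra.
Qed.

(** The initial layer supplies the starting point of [flow_convergence]: there
    w / hb, w / f, w / h and z are bounded by constants, as they would be for
    the metric rescaled to hb = 1. *)
Lemma warped_convergence (k l e rho : R) : 2 <= k -> 2 <= l ->
  0 < e < PI / 2 -> 0 < rho ->
  exists eta, 0 < eta /\
  forall T hb f fp h hp, 0 < T -> 0 < hb < eta ->
    warped_solution k l T f fp h hp ->
    (forall t, 0 < t < T -> constraint k l (f t) (fp t) (h t) (hp t)) ->
    collapses_at T f h ->
    right_limit f 0 -> right_limit fp 1 -> right_limit h hb -> right_limit hp 0 ->
    PI - e < T /\
    forall t, e <= t <= PI - e ->
      Rabs (conf_w k l (f t) (h t) - sin t) <= rho /\
      Rabs (conf_wp k l (f t) (fp t) (h t) (hp t) - cos t) <= rho /\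
      excess k l (conf_s k l (f t) (h t)) (conf_z k l (f t) (fp t) (h t) (hp t)) <= rho.
Proof.
  intros Hk Hl He Hrho.
  set (n := k + l).
  assert (HA1 := cone_radius_bounds k l Hk Hl).
  assert (HA2 := cone_radius_bounds l k Hl Hk).
  (* The bound Q for conf_w / hb at the time a = hb / (16 n). *)
  set (Q := 2 / (cone_radius k l * cone_radius l k)).
  assert (HA12 : 0 < cone_radius k l * cone_radius l k <= 1) by (split; nra).
  assert (HQ : 0 < Q) by (apply Rdiv_lt_0_compat; lra).
  assert (HQ1 : 2 <= Q * cone_radius k l).
  { replace (Q * cone_radius k l) with (2 / cone_radius l k) by (unfold Q; field; lra).
    apply le_div; lra. }
  assert (HQ2 : 2 <= Q * cone_radius l k).
  { replace (Q * cone_radius l k) with (2 / cone_radius k l) by (unfold Q; field; lra).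
    apply le_div; lra. }
  set (C0 := (Q * (32 * n)) ^ 2 + (Q * 2) ^ 2 + k * l * (Q * 68) ^ 2).
  destruct (flow_convergence k l C0 e rho Hk Hl He Hrho) as [eta0 [Heta0 Hconv]].
  set (eta := Rmin (1 / (4 * n)) (eta0 / (1 + Q))).
  assert (Hn : 4 <= n) by (unfold n; lra).
  exists eta. split.
  { apply Rmin_glb_lt; apply Rdiv_lt_0_compat; lra. }
  intros T hb f fp h hp HT Hhb S HC Hcol Lf Lfp Lh Lhp.
  assert (Hm1 := Rmin_l (1 / (4 * n)) (eta0 / (1 + Q))).
  assert (Hm2 := Rmin_r (1 / (4 * n)) (eta0 / (1 + Q))). fold eta in Hm1, Hm2.
  assert (Hhb2 : hb * (1 + Q) <= eta0).
  { apply Rle_trans with (eta0 / (1 + Q) * (1 + Q)); [apply Rmult_le_compat_r; lra|right; field; lra]. }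
  assert (Hlayer := initial_layer k l T hb f fp h hp Hk Hl HT ltac:(fold n; lra) S Hcol Lf Lfp Lh Lhp).
  cbv zeta in Hlayer. fold n in Hlayer.
  set (a := hb / (16 * n)) in *.
  assert (Hna : 16 * n * a = hb) by (unfold a; field; lra).
  assert (Ha : 0 < a) by (unfold a; apply Rdiv_lt_0_compat; lra).
  destruct Hlayer as [HaT [Gf [Gh [Gfp Ghp]]]].
  assert (F := conformal_flow_of_warped k l T f fp h hp Hk Hl S HC HT Hcol).
  assert (Hahb : 64 * a <= hb) by nra.
  assert (Hw : conf_w k l (f a) (h a) <= Q * hb).
  { apply conf_w_le; try lra.
    - apply Rle_trans with (2 * hb); [lra|]. nra.
    - apply Rle_trans with (2 * hb); [lra|]. nra. }
  assert (Hw0 := conf_w_pos k l (f a) (h a)).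
  assert (R1 : 0 < fp a / f a <= 64 * n / hb).
  { split; [apply Rdiv_lt_0_compat; lra|]. apply div_le; [lra|].
    replace (64 * n / hb * f a) with (4 * (16 * n * f a) / hb) by (field; lra).
    apply le_div; [lra|]. rewrite <- Hna. nra. }
  assert (R1' : 4 * n / hb <= fp a / f a).
  { apply le_div; [lra|].
    replace (4 * n / hb * f a) with ((4 * n * f a) / hb) by (field; lra).
    apply div_le; [lra|]. rewrite <- Hna. nra. }
  assert (Hratio : 1 / 2 <= h a / hb <= 2) by (split; [apply le_div; lra|apply div_le; lra]).
  assert (R2 : - / hb <= hp a / h a <= 4 / hb).
  { split.
    - apply le_div; [lra|].
      replace (- / hb * h a) with (- (h a / hb)) by (field; lra). lra.
    - apply div_le; [lra|].
      replace (4 / hb * h a) with (4 * (h a / hb)) by (field; lra). lra. }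
  assert (Hihb : 0 < / hb) by (apply Rinv_0_lt_compat; lra).
  apply (Hconv T _ _ _ _ a F).
  - lra.
  - nra.
  - apply Rle_trans with (Q * hb); [exact Hw|nra].
  - apply Rmult_lt_0_compat; [easy|]. apply Rdiv_lt_0_compat; [|lra].
    assert (k * (4 * n / hb) <= k * (fp a / f a)) by (apply Rmult_le_compat_l; lra).
    assert (l * - / hb <= l * (hp a / h a)) by (apply Rmult_le_compat_l; lra).
    replace (k * (4 * n / hb)) with (4 * k * n * / hb) in H by (field; lra).
    assert (l * / hb < 4 * k * n * / hb) by (apply Rmult_lt_compat_r; unfold n; nra).
    lra.
  - eapply Rle_trans; [apply excess_conf_le; lra|].
    set (W := conf_w k l (f a) (h a)) in *.
    assert (E1 : (W / f a) ^ 2 <= (Q * (32 * n)) ^ 2).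
    { apply pow_incr. split; [left; apply Rdiv_lt_0_compat; lra|].
      apply div_le; [lra|]. apply Rle_trans with (Q * hb); [easy|].
      rewrite Rmult_assoc. apply Rmult_le_compat_l; [lra|]. rewrite <- Hna. nra. }
    assert (E2 : (W / h a) ^ 2 <= (Q * 2) ^ 2).
    { apply pow_incr. split; [left; apply Rdiv_lt_0_compat; lra|].
      apply div_le; [lra|]. apply Rle_trans with (Q * hb); [easy|].
      rewrite Rmult_assoc. apply Rmult_le_compat_l; lra. }
    assert (E3 : conf_z k l (f a) (fp a) (h a) (hp a) ^ 2 <= (Q * 68) ^ 2).
    { unfold conf_z. fold W. fold n.
      assert (HX : Rabs ((fp a / f a - hp a / h a) / n) <= 68 / hb).
      { unfold Rdiv at 1. rewrite Rabs_mult, (Rabs_right (/ n)) by (left; apply Rinv_0_lt_compat; lra).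
        apply div_le; [lra|].
        replace (64 * n / hb) with (64 * n * / hb) in R1 by (field; lra).
        replace (4 * n / hb) with (4 * n * / hb) in R1' by (field; lra).
        unfold Rdiv in R2.
        replace (68 / hb * n) with (68 * n * / hb) by (field; lra).
        assert (4 * / hb <= n * / hb) by (apply Rmult_le_compat_r; lra).
        apply Rabs_le. unfold Rdiv in *. lra. }
      rewrite <- (pow2_abs (W * _)). apply pow_incr. split; [apply Rabs_pos|].
      rewrite Rabs_mult, (Rabs_right W) by lra.
      apply Rle_trans with (Q * hb * (68 / hb)).
      - apply Rmult_le_compat; [lra|apply Rabs_pos|easy|easy].
      - right. field. lra. }
    unfold C0.
    assert (0 <= k * l) by nra.
    assert (k * l * conf_z k l (f a) (fp a) (h a) (hp a) ^ 2 <= k * l * (Q * 68) ^ 2) by (now apply Rmult_le_compat_l).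
    lra.
Qed.

(** * Warping functions of Boehm metrics *)

Lemma is_derive_of_D_in (T t : R) (u u' : R -> R) :
  0 < t < T -> D_in u u' (segment 0 T) t -> is_derive u t (u' t).
Proof.
  intros Ht HD. apply is_derive_Reals.
  intros eps Heps. destruct (HD eps Heps) as [al [Hal Hlim]].
  assert (Hm : 0 < Rmin al (Rmin t (T - t))) by (repeat apply Rmin_glb_lt; lra).
  exists (mkposreal _ Hm). intros x Hx Hxm. simpl in Hxm.
  assert (M1 := Rmin_l al (Rmin t (T - t))). assert (M2 := Rmin_r al (Rmin t (T - t))).
  assert (M3 := Rmin_l t (T - t)). assert (M4 := Rmin_r t (T - t)).
  assert (Hx' := Rabs_def2 x _ Hxm).
  specialize (Hlim (t + x)). simpl in Hlim. unfold Rdist in Hlim.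
  replace (t + x - t) with x in Hlim by ring. apply Hlim.
  split; [|lra]. split; [split; lra|lra].
Qed.

(** The boundary conditions and the smoothness hypothesis each give a one-sided
    derivative at an end point; this identifies them. *)
Lemma D_in_unique (T t : R) (u u1 u2 v : R -> R) :
  0 < T -> 0 <= t <= T -> (forall x, 0 <= x <= T -> u1 x = u x) ->
  D_in u v (segment 0 T) t -> D_in u1 u2 (segment 0 T) t -> u2 t = v t.
Proof.
  intros HT Ht Heq H1 H2.
  apply (single_limit (fun x => (u x - u t) / (x - t)) (D_x (segment 0 T) t) _ _ t).
  - intros al Hal.
    destruct (Rle_or_lt t (T / 2)) as [Hle|Hgt].
    + exists (t + Rmin (al / 2) (T / 4)).
      assert (M1 := Rmin_l (al / 2) (T / 4)). assert (M2 := Rmin_r (al / 2) (T / 4)).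
      assert (M3 : 0 < Rmin (al / 2) (T / 4)) by (apply Rmin_glb_lt; lra).
      split; [split; [split; lra|lra]|]. unfold Rdist. apply Rabs_def1; lra.
    + exists (t - Rmin (al / 2) (T / 4)).
      assert (M1 := Rmin_l (al / 2) (T / 4)). assert (M2 := Rmin_r (al / 2) (T / 4)).
      assert (M3 : 0 < Rmin (al / 2) (T / 4)) by (apply Rmin_glb_lt; lra).
      split; [split; [split; lra|lra]|]. unfold Rdist. apply Rabs_def1; lra.
  - intros eps Heps. destruct (H2 eps Heps) as [al [Hal Hlim]].
    exists al. split; [easy|]. intros x Hx. specialize (Hlim x Hx).
    rewrite !Heq in Hlim; [easy|easy|apply Hx].
  - exact H1.
Qed.

Lemma limit_of_D_in (T t : R) (u u' : R -> R) : D_in u u' (segment 0 T) t ->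
  forall eps, 0 < eps -> exists d, 0 < d /\
    forall x, 0 <= x <= T -> Rabs (x - t) < d -> Rabs (u x - u t) < eps.
Proof.
  intros HD eps Heps.
  destruct (cont_deriv u u' (segment 0 T) t HD eps Heps) as [d [Hd Hlim]].
  exists d. split; [easy|]. intros x Hx Hxt.
  destruct (Req_dec t x) as [<-|Hne].
  - replace (u t - u t) with 0 by ring. now rewrite Rabs_R0.
  - apply (Hlim x). split; [split; [exact Hx|easy]|exact Hxt].
Qed.

Lemma right_limit_of_D_in (T : R) (u u' v : R -> R) : 0 < T ->
  D_in u u' (segment 0 T) 0 -> (forall x, 0 < x < T -> v x = u x) ->
  right_limit v (u 0).
Proof.
  intros HT HD Heq. apply filterlim_locally. intros eps.
  destruct (limit_of_D_in T 0 u u' HD eps (cond_pos eps)) as [d [Hd Hlim]].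
  assert (Hm : 0 < Rmin d T) by (apply Rmin_glb_lt; lra).
  exists (mkposreal _ Hm). intros x Hx Hx0.
  change (Rabs (x - 0) < Rmin d T) in Hx.
  assert (M1 := Rmin_l d T). assert (M2 := Rmin_r d T).
  rewrite Rminus_0_r, Rabs_right in Hx by lra.
  change (Rabs (v x - u 0) < eps). rewrite Heq by lra.
  apply Hlim; [lra|]. rewrite Rminus_0_r, Rabs_right; lra.
Qed.

Lemma interior_locally (T t : R) (P : R -> Prop) : 0 < t < T ->
  (forall x, 0 < x < T -> P x) -> locally t P.
Proof.
  intros Ht H.
  assert (Hm : 0 < Rmin t (T - t)) by (apply Rmin_glb_lt; lra).
  exists (mkposreal _ Hm). intros x Hx. change (Rabs (x - t) < Rmin t (T - t)) in Hx.
  assert (M1 := Rmin_l t (T - t)). assert (M2 := Rmin_r t (T - t)).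
  apply Rabs_def2 in Hx. apply H. lra.
Qed.

Lemma smooth_on_derivatives (T : R) (u : R -> R) : 0 < T -> smooth_on (segment 0 T) u ->
  exists u1 u2 : R -> R,
    D_in u u1 (segment 0 T) 0 /\ D_in u u1 (segment 0 T) T /\
    D_in u1 u2 (segment 0 T) 0 /\
    (forall t, 0 < t < T -> is_derive u t (u1 t)) /\
    (forall t, 0 < t < T -> is_derive u1 t (u2 t)).
Proof.
  intros HT [U [H0 HU]]. exists (U 1%nat), (U 2%nat).
  assert (HD : forall t, 0 <= t <= T -> D_in u (U 1%nat) (segment 0 T) t).
  { intros t Ht eps Heps. destruct (HU 0%nat t Ht eps Heps) as [al [Hal Hlim]].
    exists al. split; [easy|]. intros x Hx. specialize (Hlim x Hx).
    rewrite !H0 in Hlim; [easy|easy|apply Hx]. }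
  split; [|split; [|split; [|split]]].
  - apply HD. lra.
  - apply HD. lra.
  - apply HU. split; lra.
  - intros t Ht. apply (is_derive_of_D_in T); [easy|]. apply HD. lra.
  - intros t Ht. apply (is_derive_of_D_in T); [easy|]. apply HU. split; lra.
Qed.

Lemma bounded_of_smooth (T : R) (u u1 : R -> R) : 0 < T ->
  D_in u u1 (segment 0 T) 0 -> D_in u u1 (segment 0 T) T ->
  (forall t, 0 < t < T -> is_derive u t (u1 t)) ->
  exists B, forall t, 0 < t < T -> u t <= B.
Proof.
  intros HT H0 HT' Hd.
  destruct (limit_of_D_in T 0 u u1 H0 1 Rlt_0_1) as [d0 [Hd0 L0]].
  destruct (limit_of_D_in T T u u1 HT' 1 Rlt_0_1) as [d1 [Hd1 L1]].
  set (a := Rmin d0 T / 2). set (b := T - Rmin d1 T / 2).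
  assert (M1 := Rmin_l d0 T). assert (M2 := Rmin_r d0 T).
  assert (M3 : 0 < Rmin d0 T) by (apply Rmin_glb_lt; lra).
  assert (N1 := Rmin_l d1 T). assert (N2 := Rmin_r d1 T).
  assert (N3 : 0 < Rmin d1 T) by (apply Rmin_glb_lt; lra).
  destruct (continuity_ab_maj u a b) as [m [Hm _]].
  { unfold a, b. lra. }
  { intros x Hx. apply continuity_pt_filterlim.
    apply (continuous_of_derive u x (u1 x)), Hd. unfold a, b in Hx. lra. }
  exists (Rmax (u m) (Rmax (u 0 + 1) (u T + 1))).
  intros t Ht.
  assert (P1 := Rmax_l (u m) (Rmax (u 0 + 1) (u T + 1))).
  assert (P2 := Rmax_r (u m) (Rmax (u 0 + 1) (u T + 1))).
  assert (P3 := Rmax_l (u 0 + 1) (u T + 1)). assert (P4 := Rmax_r (u 0 + 1) (u T + 1)).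
  destruct (Rlt_or_le t a) as [Ha|Ha].
  - assert (H := L0 t ltac:(lra) ltac:(apply Rabs_def1; unfold a in *; lra)).
    apply Rabs_def2 in H. lra.
  - destruct (Rle_or_lt t b) as [Hb|Hb].
    + assert (H := Hm t ltac:(lra)). lra.
    + assert (H := L1 t ltac:(lra) ltac:(apply Rabs_def1; unfold b in *; lra)).
      apply Rabs_def2 in H. lra.
Qed.

Lemma vanishing_end (T : R) (u u1 : R -> R) : 0 < T ->
  D_in u u1 (segment 0 T) T -> u T = 0 ->
  forall a d, a < T -> 0 < d -> exists t, a < t < T /\ u t < d.
Proof.
  intros HT HD Hend a d Ha Hd.
  destruct (limit_of_D_in T T u u1 HD d Hd) as [d1 [Hd1 L1]].
  assert (M1 := Rmax_l (Rmax 0 a) (T - d1)). assert (M2 := Rmax_r (Rmax 0 a) (T - d1)).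
  assert (M3 := Rmax_l 0 a). assert (M4 := Rmax_r 0 a).
  assert (M5 : Rmax (Rmax 0 a) (T - d1) < T) by (repeat apply Rmax_lub_lt; lra).
  set (t := (Rmax (Rmax 0 a) (T - d1) + T) / 2).
  exists t. split; [unfold t; lra|].
  assert (H := L1 t ltac:(unfold t; lra) ltac:(unfold t; apply Rabs_def1; lra)).
  apply Rabs_def2 in H. lra.
Qed.

(** The second and third Einstein equations are the equations of motion; the
    first one becomes the constraint. *)
Lemma bohm_warped_solution (k l : nat) (M : manifold) (g : profile) :
  (2 <= k)%nat -> (2 <= l)%nat ->
  bohm_metric k l M (INR (k + l)) g ->
  let T := prof_T g in
  let f := prof_f g in
  let h := prof_h g in
  warped_solution (INR k) (INR l) T f (Derive f) h (Derive h) /\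
  (forall t, 0 < t < T -> constraint (INR k) (INR l) (f t) (Derive f t) (h t) (Derive h t)) /\
  collapses_at T f h /\
  0 < T /\ 0 < h 0 /\
  right_limit f 0 /\ right_limit (Derive f) 1 /\
  right_limit h (h 0) /\ right_limit (Derive h) 0.
Proof.
  intros Hk Hl [HL HT Sf Sh Pf Ph [[Bf0 [Bf1 [Bh0 Bh1]]] Bend] _ HE] T f h.
  fold T in HT, Pf, Ph, Sf, Sh, Bf1, Bh1, Bend. fold f in Pf, Sf, Bf0, Bf1, Bend. fold h in Ph, Sh, Bh0, Bh1, Bend.
  unfold einstein_equations in HE. fold T f h in HE.
  destruct (smooth_on_derivatives T f HT Sf) as [f1 [f2 [F0 [FT [F10 [F1 F2]]]]]].
  destruct (smooth_on_derivatives T h HT Sh) as [h1 [h2 [H0 [HT1 [H10 [H1 H2]]]]]].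
  assert (Df : forall t, 0 < t < T -> Derive f t = f1 t).
  { intros t Ht. now apply is_derive_unique, F1. }
  assert (Dh : forall t, 0 < t < T -> Derive h t = h1 t).
  { intros t Ht. now apply is_derive_unique, H1. }
  assert (DDf : forall t, 0 < t < T -> is_derive (Derive f) t (f2 t)).
  { intros t Ht. apply (is_derive_ext_loc f1); [|now apply F2].
    apply (interior_locally T); [easy|]. intros x Hx. symmetry. now apply Df. }
  assert (DDh : forall t, 0 < t < T -> is_derive (Derive h) t (h2 t)).
  { intros t Ht. apply (is_derive_ext_loc h1); [|now apply H2].
    apply (interior_locally T); [easy|]. intros x Hx. symmetry. now apply Dh. }
  assert (HE' : forall t, 0 < t < T ->
    f2 t = warp_acc (INR k) (INR l) (f t) (Derive f t) (h t) (Derive h t) /\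
    h2 t = warp_acc (INR l) (INR k) (h t) (Derive h t) (f t) (Derive f t) /\
    - (INR k + INR l) = INR k * (f2 t / f t) + INR l * (h2 t / h t)).
  { intros t Ht. destruct (HE t Ht) as [E1 [E2 E3]].
    change (Derive_n f 2 t) with (Derive (Derive f) t) in *.
    change (Derive_n h 2 t) with (Derive (Derive h) t) in *.
    rewrite (is_derive_unique _ _ _ (DDf t Ht)), (is_derive_unique _ _ _ (DDh t Ht)) in *.
    assert (Pft := Pf t Ht). assert (Pht := Ph t Ht).
    rewrite plus_INR in *.
    split; [|split].
    - unfold warp_acc. apply (Rmult_eq_reg_r (/ f t)); [|apply Rinv_neq_0_compat; lra].
      change (f2 t * / f t) with (f2 t / f t).
      replace (f2 t / f t) with (- (INR k + INR l) +
        (INR k - 1) * ((1 - Derive f t ^ 2) / f t ^ 2) - INR l * (Derive f t * Derive h t / (f t * h t))) by lra.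
      field. lra.
    - unfold warp_acc. apply (Rmult_eq_reg_r (/ h t)); [|apply Rinv_neq_0_compat; lra].
      change (h2 t * / h t) with (h2 t / h t).
      replace (h2 t / h t) with (- (INR k + INR l) +
        (INR l - 1) * ((1 - Derive h t ^ 2) / h t ^ 2) - INR k * (Derive f t * Derive h t / (f t * h t))) by lra.
      field. lra.
    - lra. }
  split.
  { constructor.
    - exact Pf.
    - exact Ph.
    - intros t Ht. rewrite Df by easy. now apply F1.
    - intros t Ht. rewrite Dh by easy. now apply H1.
    - intros t Ht. destruct (HE' t Ht) as [<- _]. now apply DDf.
    - intros t Ht. destruct (HE' t Ht) as [_ [<- _]]. now apply DDh. }
  split.
  { intros t Ht. destruct (HE' t Ht) as [E1 [E2 E3]].
    unfold constraint. now rewrite <- E1, <- E2. }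
  split.
  { destruct (bounded_of_smooth T f f1 HT F0 FT F1) as [Mf HMf].
    destruct (bounded_of_smooth T h h1 HT H0 HT1 H1) as [Mh HMh].
    split.
    - exists (Rmax Mf Mh). intros t Ht.
      assert (Q1 := Rmax_l Mf Mh). assert (Q2 := Rmax_r Mf Mh).
      assert (Q3 := HMf t Ht). assert (Q4 := HMh t Ht). lra.
    - intros a d Ha Hd. destruct M.
      + destruct Bend as [_ [_ [Bh _]]].
        destruct (vanishing_end T h h1 HT HT1 Bh a d Ha Hd) as [t [Ht Htd]].
        exists t. split; [easy|now right].
      + destruct Bend as [Bf _].
        destruct (vanishing_end T f f1 HT FT Bf a d Ha Hd) as [t [Ht Htd]].
        exists t. split; [easy|now left]. }
  split; [easy|]. split; [easy|].
  assert (Hs : 0 <= 0 <= T) by lra.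
  assert (V1 : f1 0 = 1).
  { apply (D_in_unique T 0 f f f1 (fun _ => 1)); easy. }
  assert (V2 : h1 0 = 0).
  { apply (D_in_unique T 0 h h h1 (fun _ => 0)); easy. }
  split; [|split; [|split]].
  - rewrite <- Bf0. apply (right_limit_of_D_in T f f1); easy.
  - rewrite <- V1. apply (right_limit_of_D_in T f1 f2); easy.
  - apply (right_limit_of_D_in T h h1); easy.
  - rewrite <- V2. apply (right_limit_of_D_in T h1 h2); easy.
Qed.

(** * Uniform convergence *)

Definition uniform_cv (K : R -> Prop) (u : nat -> R -> R) (v : R -> R) : Prop :=
  forall eps, 0 < eps -> eventually (fun i => forall t, K t -> Rabs (u i t - v t) < eps).

Definition bounded_on (K : R -> Prop) (v : R -> R) : Prop :=
  exists B, forall t, K t -> Rabs (v t) <= B.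

Lemma uniform_cv_ext (K : R -> Prop) (u u' : nat -> R -> R) (v v' : R -> R) :
  eventually (fun i => forall t, K t -> u i t = u' i t) ->
  (forall t, K t -> v t = v' t) ->
  uniform_cv K u v -> uniform_cv K u' v'.
Proof.
  intros Hu Hv H eps Heps.
  generalize (filter_and _ _ Hu (H eps Heps)). apply filter_imp.
  intros i [H1 H2] t Ht. rewrite <- H1, <- Hv by easy. now apply H2.
Qed.

Lemma uniform_cv_const (K : R -> Prop) (v : R -> R) : uniform_cv K (fun _ => v) v.
Proof.
  intros eps Heps. exists 0%nat. intros i _ t _. now rewrite Rminus_eq_0, Rabs_R0.
Qed.

Lemma uniform_cv_plus (K : R -> Prop) (u1 u2 : nat -> R -> R) (v1 v2 : R -> R) :
  uniform_cv K u1 v1 -> uniform_cv K u2 v2 ->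
  uniform_cv K (fun i t => u1 i t + u2 i t) (fun t => v1 t + v2 t).
Proof.
  intros H1 H2 eps Heps.
  assert (He2 : 0 < eps / 2) by lra.
  generalize (filter_and _ _ (H1 _ He2) (H2 _ He2)).
  apply filter_imp. intros i [E1 E2] t Ht. specialize (E1 t Ht). specialize (E2 t Ht).
  replace (u1 i t + u2 i t - (v1 t + v2 t)) with ((u1 i t - v1 t) + (u2 i t - v2 t)) by ring.
  eapply Rle_lt_trans; [apply Rabs_triang|lra].
Qed.

Lemma uniform_cv_mult (K : R -> Prop) (u1 u2 : nat -> R -> R) (v1 v2 : R -> R) :
  bounded_on K v1 -> bounded_on K v2 ->
  uniform_cv K u1 v1 -> uniform_cv K u2 v2 ->
  uniform_cv K (fun i t => u1 i t * u2 i t) (fun t => v1 t * v2 t).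
Proof.
  intros [B1 HB1] [B2 HB2] H1 H2 eps Heps.
  set (C := 1 + Rabs B1 + Rabs B2).
  assert (Hb1 := Rle_abs B1). assert (Hb2 := Rle_abs B2).
  assert (Hp1 := Rabs_pos B1). assert (Hp2 := Rabs_pos B2).
  set (e := Rmin 1 (eps / (2 * C))).
  assert (HC : 1 <= C) by (unfold C; lra).
  assert (He : 0 < e) by (apply Rmin_glb_lt; [lra|apply Rdiv_lt_0_compat; lra]).
  assert (He1 : e <= 1) by apply Rmin_l.
  assert (He2 : e <= eps / (2 * C)) by apply Rmin_r.
  assert (HeC : C * e <= eps / 2).
  { apply Rle_trans with (C * (eps / (2 * C))); [apply Rmult_le_compat_l; lra|right; field; lra]. }
  generalize (filter_and _ _ (H1 e He) (H2 e He)).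
  apply filter_imp. intros i [E1 E2] t Ht. specialize (E1 t Ht). specialize (E2 t Ht).
  specialize (HB1 t Ht). specialize (HB2 t Ht).
  replace (u1 i t * u2 i t - v1 t * v2 t) with
    ((u1 i t - v1 t) * (u2 i t - v2 t) + (u1 i t - v1 t) * v2 t + v1 t * (u2 i t - v2 t)) by ring.
  eapply Rle_lt_trans; [apply Rabs_triang|].
  assert (T1 := Rabs_triang ((u1 i t - v1 t) * (u2 i t - v2 t)) ((u1 i t - v1 t) * v2 t)).
  rewrite !Rabs_mult in *.
  assert (P1 := Rabs_pos (u1 i t - v1 t)). assert (P2 := Rabs_pos (u2 i t - v2 t)).
  assert (P3 := Rabs_pos (v1 t)). assert (P4 := Rabs_pos (v2 t)).
  assert (Rabs (u1 i t - v1 t) * Rabs (u2 i t - v2 t) <= e * 1) by (apply Rmult_le_compat; lra).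
  assert (Rabs (u1 i t - v1 t) * Rabs (v2 t) <= e * Rabs B2) by (apply Rmult_le_compat; lra).
  assert (Rabs (v1 t) * Rabs (u2 i t - v2 t) <= Rabs B1 * e) by (apply Rmult_le_compat; lra).
  unfold C in HeC. lra.
Qed.

Lemma uniform_cv_inv (K : R -> Prop) (u : nat -> R -> R) (v : R -> R) (m : R) :
  0 < m -> (forall t, K t -> m <= v t) ->
  uniform_cv K u v -> uniform_cv K (fun i t => / u i t) (fun t => / v t).
Proof.
  intros Hm Hv H eps Heps.
  assert (He : 0 < Rmin (m / 2) (eps * (m * m / 2))).
  { apply Rmin_glb_lt; [lra|]. repeat apply Rmult_lt_0_compat; lra. }
  assert (M1 := Rmin_l (m / 2) (eps * (m * m / 2))).
  assert (M2 := Rmin_r (m / 2) (eps * (m * m / 2))).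
  generalize (H _ He). apply filter_imp. intros i E t Ht.
  specialize (E t Ht). specialize (Hv t Ht).
  assert (E' := Rabs_def2 _ _ E).
  assert (Hu : m / 2 <= u i t) by lra.
  replace (/ u i t - / v t) with (- (u i t - v t) / (u i t * v t)) by (field; lra).
  assert (Huv : m * m / 2 <= u i t * v t) by nra.
  unfold Rdiv. rewrite Rabs_mult, Rabs_Ropp, Rabs_inv, (Rabs_right (u i t * v t)) by nra.
  apply Rlt_div_l; [nra|].
  apply Rlt_le_trans with (eps * (m * m / 2)); [lra|]. apply Rmult_le_compat_l; lra.
Qed.

Lemma uniform_cv_exp (K : R -> Prop) (u : nat -> R -> R) :
  uniform_cv K u (fun _ => 0) -> uniform_cv K (fun i t => exp (u i t)) (fun _ => 1).
Proof.
  intros H eps Heps.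
  assert (Hc : continuous exp 0) by (apply (continuous_of_derive _ _ _ (is_derive_exp 0))).
  destruct (proj1 (filterlim_locally exp (exp 0)) Hc (mkposreal _ Heps)) as [d Hd].
  generalize (H d (cond_pos d)). apply filter_imp. intros i E t Ht.
  rewrite <- exp_0. apply (Hd (u i t)). exact (E t Ht).
Qed.

Lemma bounded_on_plus (K : R -> Prop) (v1 v2 : R -> R) :
  bounded_on K v1 -> bounded_on K v2 -> bounded_on K (fun t => v1 t + v2 t).
Proof.
  intros [B1 H1] [B2 H2]. exists (B1 + B2). intros t Ht.
  eapply Rle_trans; [apply Rabs_triang|]. specialize (H1 t Ht). specialize (H2 t Ht). lra.
Qed.

Lemma bounded_on_mult (K : R -> Prop) (v1 v2 : R -> R) :
  bounded_on K v1 -> bounded_on K v2 -> bounded_on K (fun t => v1 t * v2 t).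
Proof.
  intros [B1 H1] [B2 H2]. exists (B1 * B2). intros t Ht.
  rewrite Rabs_mult. apply Rmult_le_compat; auto using Rabs_pos.
Qed.

(** * Higher derivatives as polynomials in the 1-jet *)

Inductive jet_coord : Set := JF | JFp | JFinv | JH | JHp | JHinv.

(** Expressions rather than functions, so that differentiation along solutions
    is an operation on them that depends only on k and l. *)
Inductive jet_poly : Type :=
  | Jvar (c : jet_coord)
  | Jconst (r : R)
  | Jadd (p q : jet_poly)
  | Jmul (p q : jet_poly).

Fixpoint jet_eval (j : jet_coord -> R) (p : jet_poly) : R :=
  match p with
  | Jvar c => j c
  | Jconst r => r
  | Jadd p q => jet_eval j p + jet_eval j q
  | Jmul p q => jet_eval j p * jet_eval j q
  end.

Definition jet (f fp h hp : R -> R) (t : R) (c : jet_coord) : R :=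
  match c with
  | JF => f t | JFp => fp t | JFinv => / f t
  | JH => h t | JHp => hp t | JHinv => / h t
  end.

(** [warp_acc] as a polynomial in the jet. *)
Definition acc_poly (k l : R) (f fp finv hp hinv : jet_coord) : jet_poly :=
  Jadd (Jmul (Jconst (- (k + l))) (Jvar f))
    (Jadd (Jmul (Jconst (k - 1))
             (Jmul (Jadd (Jconst 1) (Jmul (Jconst (-1)) (Jmul (Jvar fp) (Jvar fp)))) (Jvar finv)))
          (Jmul (Jconst (- l)) (Jmul (Jmul (Jvar fp) (Jvar hp)) (Jvar hinv)))).

Definition coord_deriv (k l : R) (c : jet_coord) : jet_poly :=
  match c with
  | JF => Jvar JFp
  | JFp => acc_poly k l JF JFp JFinv JHp JHinv
  | JFinv => Jmul (Jconst (-1)) (Jmul (Jvar JFp) (Jmul (Jvar JFinv) (Jvar JFinv)))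
  | JH => Jvar JHp
  | JHp => acc_poly l k JH JHp JHinv JFp JFinv
  | JHinv => Jmul (Jconst (-1)) (Jmul (Jvar JHp) (Jmul (Jvar JHinv) (Jvar JHinv)))
  end.

Fixpoint jet_deriv (k l : R) (p : jet_poly) : jet_poly :=
  match p with
  | Jvar c => coord_deriv k l c
  | Jconst _ => Jconst 0
  | Jadd p q => Jadd (jet_deriv k l p) (jet_deriv k l q)
  | Jmul p q => Jadd (Jmul (jet_deriv k l p) q) (Jmul p (jet_deriv k l q))
  end.

Lemma is_derive_inv_pos (u : R -> R) (t du : R) : 0 < u t -> is_derive u t du ->
  is_derive (fun t => / u t) t (-1 * (du * (/ u t * / u t))).
Proof.
  intros Hu Hd. auto_derive.
  - repeat split; [eexists; exact Hd|lra].
  - erewrite (is_derive_unique _ t) by exact Hd. field. lra.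
Qed.

(** [jet_deriv] is the derivation given by the Einstein equations. *)
Lemma jet_eval_derive (k l T : R) (f fp h hp : R -> R) (p : jet_poly) (t : R) :
  warped_solution k l T f fp h hp -> 0 < t < T ->
  is_derive (fun t => jet_eval (jet f fp h hp t) p) t
    (jet_eval (jet f fp h hp t) (jet_deriv k l p)).
Proof.
  intros S Ht.
  assert (Hf := ws_f_pos S t Ht). assert (Hh := ws_h_pos S t Ht).
  assert (H1 := ws_f S t Ht). assert (H2 := ws_h S t Ht).
  assert (H3 := ws_fp S t Ht). assert (H4 := ws_hp S t Ht).
  induction p as [c|r|p IHp q IHq|p IHp q IHq]; simpl.
  - destruct c; simpl.
    + exact H1.
    + evar_last; [exact H3|]. unfold warp_acc, Rdiv. ring.
    + now apply is_derive_inv_pos.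
    + exact H2.
    + evar_last; [exact H4|]. unfold warp_acc, Rdiv. ring.
    + now apply is_derive_inv_pos.
  - apply (is_derive_const r).
  - apply (is_derive_plus _ _ t _ _ IHp IHq).
  - apply (is_derive_mult _ _ t _ _ IHp IHq Rmult_comm).
Qed.

Lemma Derive_n_jet (k l T : R) (f fp h hp u : R -> R) (p : jet_poly) (n : nat) :
  warped_solution k l T f fp h hp ->
  (forall t, 0 < t < T -> u t = jet_eval (jet f fp h hp t) p) ->
  forall t, 0 < t < T ->
    Derive_n u n t = jet_eval (jet f fp h hp t) (Nat.iter n (jet_deriv k l) p).
Proof.
  intros S Hu. induction n as [|n IH]; intros t Ht; [now apply Hu|].
  simpl. apply is_derive_unique.
  apply (is_derive_ext_loc (fun t => jet_eval (jet f fp h hp t) (Nat.iter n (jet_deriv k l) p))).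
  - apply (interior_locally T); [easy|]. intros x Hx. symmetry. now apply IH.
  - now apply (jet_eval_derive k l T).
Qed.

(** The bound on the limit is carried along for the sake of products. *)
Lemma uniform_cv_jet_eval (K : R -> Prop) (J : nat -> R -> jet_coord -> R)
    (j : R -> jet_coord -> R) (p : jet_poly) :
  (forall c, uniform_cv K (fun i t => J i t c) (fun t => j t c)) ->
  (forall c, bounded_on K (fun t => j t c)) ->
  uniform_cv K (fun i t => jet_eval (J i t) p) (fun t => jet_eval (j t) p) /\
  bounded_on K (fun t => jet_eval (j t) p).
Proof.
  intros HJ Hj. induction p as [c|r|p [IHp Bp] q [IHq Bq]|p [IHp Bp] q [IHq Bq]]; simpl.
  - now split.
  - split; [apply uniform_cv_const|]. exists (Rabs r). intros t _. apply Rle_refl.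
  - split; [now apply uniform_cv_plus|now apply bounded_on_plus].
  - split; [now apply uniform_cv_mult|now apply bounded_on_mult].
Qed.

(** * The limit of a sequence of Boehm metrics *)

Lemma cone_warped_solution (k l : R) : 2 <= k -> 2 <= l ->
  warped_solution k l PI
    (fun t => cone_radius k l * sin t) (fun t => cone_radius k l * cos t)
    (fun t => cone_radius l k * sin t) (fun t => cone_radius l k * cos t).
Proof.
  intros Hk Hl.
  assert (Hacc : forall x y t, 2 <= x -> 2 <= y -> 0 < t < PI ->
    is_derive (fun t => cone_radius x y * cos t) t
      (warp_acc x y (cone_radius x y * sin t) (cone_radius x y * cos t)
         (cone_radius y x * sin t) (cone_radius y x * cos t))).
  { intros x y t Hx Hy Ht.
    assert (Hs := sin_gt_0 t ltac:(lra) ltac:(lra)).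
    assert (A1 := cone_radius_bounds x y Hx Hy).
    assert (A2 := cone_radius_bounds y x Hy Hx).
    assert (Q := cone_radius_sq x y Hx Hy).
    assert (SC := sin2_cos2 t). unfold Rsqr in SC.
    auto_derive; [easy|]. unfold warp_acc.
    set (A := cone_radius x y) in *. set (A' := cone_radius y x) in *.
    set (sn := sin t) in *. set (cs := cos t) in *.
    assert (HQ : x - 1 = (x + y - 1) * A ^ 2) by (rewrite Q; field; lra).
    assert (HC : cs ^ 2 = 1 - sn ^ 2) by (simpl; lra).
    replace (y * (A * cs) * (A' * cs) / (A' * sn)) with (y * A * cs ^ 2 / sn) by (field; lra).
    replace ((x - 1) * (1 - (A * cs) ^ 2) / (A * sn)) with
      (((x - 1) - (x - 1) * A ^ 2 * cs ^ 2) / (A * sn)) by (field; lra).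
    rewrite HQ at 1. rewrite HC.
    replace (((x + y - 1) * A ^ 2 - (x - 1) * A ^ 2 * (1 - sn ^ 2)) / (A * sn))
      with (A * (y + (x - 1) * sn ^ 2) / sn) by (field; lra).
    field. lra. }
  constructor.
  - intros t Ht. apply Rmult_lt_0_compat; [now apply cone_radius_bounds|apply sin_gt_0; lra].
  - intros t Ht. apply Rmult_lt_0_compat; [now apply cone_radius_bounds|apply sin_gt_0; lra].
  - intros t Ht. auto_derive; [easy|ring].
  - intros t Ht. auto_derive; [easy|ring].
  - intros t Ht. now apply Hacc.
  - intros t Ht. now apply Hacc.
Qed.

Lemma uniform_cv_of_sq (K : R -> Prop) (u : nat -> R -> R) :
  (forall rho, 0 < rho -> eventually (fun i => forall t, K t -> u i t ^ 2 <= rho)) ->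
  uniform_cv K u (fun _ => 0).
Proof.
  intros H eps Heps. generalize (H ((eps / 2) ^ 2) ltac:(apply pow_lt; lra)).
  apply filter_imp. intros i E t Ht. rewrite Rminus_0_r.
  apply Rle_lt_trans with (eps / 2); [|lra]. apply abs_le_of_sq; [lra|now apply E].
Qed.

(** The strict inequality survives the supremum because of the margin between
    e and eps. *)
Lemma sup_norm_lt (K : R -> Prop) (u : R -> R) (e eps : R) : 0 <= e < eps ->
  (forall t, K t -> Rabs (u t) <= e) -> Rbar_lt (sup_norm K u) (Finite eps).
Proof.
  intros He Hu. apply Rbar_le_lt_trans with (Finite e); [|simpl; lra].
  apply (proj2 (Lub_Rbar_correct _)). intros y [->|[t [Ht ->]]]; simpl; [lra|now apply Hu].
Qed.

(** A compact set is closed, so its complement contains a neighbourhood of each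
    end point. *)
Lemma compact_in_open_interval (K : R -> Prop) (a b : R) : a < b -> compact K ->
  (forall t, K t -> a < t < b) ->
  exists e, 0 < e < (b - a) / 2 /\ forall t, K t -> a + e <= t <= b - e.
Proof.
  intros Hab HK HKin. assert (Hcl := compact_P2 K HK).
  assert (Hfar : forall x, ~ K x -> exists e, 0 < e /\ forall t, Rabs (t - x) < e -> ~ K t).
  { intros x Hx. destruct (Hcl x Hx) as [d Hd]. exists d. split; [apply cond_pos|].
    intros t Ht. apply Hd. exact Ht. }
  destruct (Hfar a) as [e1 [He1 F1]]; [intros Ha; specialize (HKin a Ha); lra|].
  destruct (Hfar b) as [e2 [He2 F2]]; [intros Ha; specialize (HKin b Ha); lra|].
  assert (Hm : 0 < Rmin ((b - a) / 4) (Rmin e1 e2)) by (repeat apply Rmin_glb_lt; lra).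
  assert (M1 := Rmin_l ((b - a) / 4) (Rmin e1 e2)).
  assert (M2 := Rmin_r ((b - a) / 4) (Rmin e1 e2)).
  assert (M3 := Rmin_l e1 e2). assert (M4 := Rmin_r e1 e2).
  exists (Rmin ((b - a) / 4) (Rmin e1 e2)). split; [lra|].
  intros t Ht. specialize (HKin t Ht). split; apply Rnot_lt_le; intros Hlt.
  - apply (F1 t); [apply Rabs_def1; lra|easy].
  - apply (F2 t); [apply Rabs_def1; lra|easy].
Qed.

(** Both f and f' are products of w, w', z and exponentials of multiples of s,
    and s and z tend to 0 because the excess dominates their squares. *)
Lemma bohm_sequence_uniform (k l : nat) (M : manifold) (g : nat -> profile) (e : R) :
  (2 <= k)%nat -> (2 <= l)%nat -> bohm_sequence k l M g -> 0 < e < PI / 2 ->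
  let K := fun t => e <= t <= PI - e in
  eventually (fun i => PI - e < prof_T (g i)) /\
  forall c, uniform_cv K
    (fun i t => jet (prof_f (g i)) (Derive (prof_f (g i))) (prof_h (g i)) (Derive (prof_h (g i))) t c)
    (fun t => jet (fun t => cone_radius (INR k) (INR l) * sin t)
       (fun t => cone_radius (INR k) (INR l) * cos t)
       (fun t => cone_radius (INR l) (INR k) * sin t)
       (fun t => cone_radius (INR l) (INR k) * cos t) t c) /\
    bounded_on K (fun t => jet (fun t => cone_radius (INR k) (INR l) * sin t)
       (fun t => cone_radius (INR k) (INR l) * cos t)
       (fun t => cone_radius (INR l) (INR k) * sin t)
       (fun t => cone_radius (INR l) (INR k) * cos t) t c).
Proof.
  intros Hk Hl Hg He K.
  assert (Hk' : 2 <= INR k) by (apply (le_INR 2 k Hk)).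
  assert (Hl' : 2 <= INR l) by (apply (le_INR 2 l Hl)).
  set (x := INR k) in *. set (y := INR l) in *.
  set (f := fun i => prof_f (g i)). set (h := fun i => prof_h (g i)).
  set (W := fun i t => conf_w x y (f i t) (h i t)).
  set (W' := fun i t => conf_wp x y (f i t) (Derive (f i) t) (h i t) (Derive (h i) t)).
  set (S := fun i t => conf_s x y (f i t) (h i t)).
  set (Z := fun i t => conf_z x y (f i t) (Derive (f i) t) (h i t) (Derive (h i) t)).
  assert (Hev : forall rho, 0 < rho -> eventually (fun i => PI - e < prof_T (g i) /\
    forall t, K t -> Rabs (W i t - sin t) <= rho /\ Rabs (W' i t - cos t) <= rho /\
      excess x y (S i t) (Z i t) <= rho)).
  { intros rho Hrho.
    destruct (warped_convergence x y e rho Hk' Hl' He Hrho) as [eta [Heta Hconv]].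
    destruct (proj1 (filterlim_locally _ _) (bseq_h0_lim _ _ _ _ Hg) (mkposreal _ Heta)) as [N HN].
    exists N. intros i Hi.
    destruct (bohm_warped_solution k l M (g i) Hk Hl (bseq_metric _ _ _ _ Hg i))
      as [Hs [HC [Hcol [HT [Hh0 [L1 [L2 [L3 L4]]]]]]]].
    apply (Hconv _ (prof_h (g i) 0)); try easy.
    split; [easy|]. specialize (HN i Hi). change (Rabs (prof_h (g i) 0 - 0) < eta) in HN.
    apply Rabs_def2 in HN. lra. }
  assert (HT : eventually (fun i => PI - e < prof_T (g i))).
  { generalize (Hev 1 Rlt_0_1). apply filter_imp. now intros i [H _]. }
  split; [exact HT|].
  assert (HPI := PI_RGT_0).
  assert (Hpos : eventually (fun i => forall t, K t -> 0 < f i t /\ 0 < h i t)).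
  { generalize HT. apply filter_imp. intros i Hi t Ht. unfold K in Ht.
    assert (B := bseq_metric _ _ _ _ Hg i).
    split; [apply (bohm_f_pos _ _ _ _ _ B)|apply (bohm_h_pos _ _ _ _ _ B)]; lra. }
  assert (UW : uniform_cv K W sin).
  { intros eps Heps. generalize (Hev (eps / 2) ltac:(lra)). apply filter_imp.
    intros i [_ E] t Ht. destruct (E t Ht) as [E1 _]. lra. }
  assert (UW' : uniform_cv K W' cos).
  { intros eps Heps. generalize (Hev (eps / 2) ltac:(lra)). apply filter_imp.
    intros i [_ E] t Ht. destruct (E t Ht) as [_ [E1 _]]. lra. }
  assert (US : uniform_cv K S (fun _ => 0)).
  { apply uniform_cv_of_sq. intros rho Hrho. generalize (Hev rho Hrho). apply filter_imp.
    intros i [_ E] t Ht. destruct (E t Ht) as [_ [_ E1]].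
    eapply Rle_trans; [apply (shape_excess_controls_s x y); easy|].
    eapply Rle_trans; [now apply shape_excess_le_excess|exact E1]. }
  assert (UZ : uniform_cv K Z (fun _ => 0)).
  { apply uniform_cv_of_sq. intros rho Hrho. generalize (Hev rho Hrho). apply filter_imp.
    intros i [_ E] t Ht. destruct (E t Ht) as [_ [_ E1]].
    eapply Rle_trans; [now apply (excess_controls_z x y)|exact E1]. }
  assert (Bc : forall r, bounded_on K (fun _ => r)).
  { intros r. exists (Rabs r). intros. apply Rle_refl. }
  assert (Bsin : bounded_on K sin).
  { exists 1. intros t _. apply Rabs_le. apply SIN_bound. }
  assert (Bcos : bounded_on K cos).
  { exists 1. intros t _. apply Rabs_le. apply COS_bound. }
  assert (Ulin : forall (u : nat -> R -> R) r, uniform_cv K u (fun _ => 0) ->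
    uniform_cv K (fun i t => r * u i t) (fun _ => 0)).
  { intros u r Hu.
    apply (uniform_cv_ext K (fun i t => r * u i t) _ (fun _ => r * 0)).
    - exists 0%nat. easy.
    - intros t _. ring.
    - apply (uniform_cv_mult K (fun _ _ => r)); auto using uniform_cv_const. }
  assert (Uexp : forall r, uniform_cv K (fun i t => exp (r * S i t)) (fun _ => 1)).
  { intros r. apply uniform_cv_exp. now apply Ulin. }
  (* f = A w e^(l s), f' = A e^(l s) (w' + l z), and the same for h. *)
  assert (Uv : forall A r, uniform_cv K (fun i t => A * (W i t * exp (r * S i t))) (fun t => A * sin t)).
  { intros A r. apply (uniform_cv_ext K (fun i t => A * (W i t * exp (r * S i t))) _ (fun t => A * (sin t * 1))).
    - exists 0%nat. easy.
    - intros t _. ring.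
    - apply (uniform_cv_mult K (fun _ _ => A)); [apply Bc|now apply bounded_on_mult|apply uniform_cv_const|].
      now apply uniform_cv_mult. }
  assert (Ud : forall A r, uniform_cv K (fun i t => A * (exp (r * S i t) * (W' i t + r * Z i t))) (fun t => A * cos t)).
  { intros A r. apply (uniform_cv_ext K (fun i t => A * (exp (r * S i t) * (W' i t + r * Z i t))) _ (fun t => A * (1 * (cos t + 0)))).
    - exists 0%nat. easy.
    - intros t _. ring.
    - assert (Bcos0 : bounded_on K (fun t => cos t + 0)) by (now apply bounded_on_plus).
      apply (uniform_cv_mult K (fun _ _ => A)); [apply Bc|now apply bounded_on_mult|apply uniform_cv_const|].
      apply uniform_cv_mult; auto.
      apply uniform_cv_plus; auto. }
  assert (A1 := cone_radius_bounds x y Hk' Hl').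
  assert (A2 := cone_radius_bounds y x Hl' Hk').
  assert (UF : uniform_cv K f (fun t => cone_radius x y * sin t)).
  { eapply uniform_cv_ext; [| |apply (Uv (cone_radius x y) y)]; [|easy].
    generalize Hpos. apply filter_imp. intros i Hi t Ht. destruct (Hi t Ht) as [Hf Hh].
    symmetry. now apply conf_f. }
  assert (UH : uniform_cv K h (fun t => cone_radius y x * sin t)).
  { eapply uniform_cv_ext; [| |apply (Uv (cone_radius y x) (- x))]; [|easy].
    generalize Hpos. apply filter_imp. intros i Hi t Ht. destruct (Hi t Ht) as [Hf Hh].
    symmetry. replace (- x * S i t) with (- (x * S i t)) by ring. now apply conf_h. }
  assert (UF' : uniform_cv K (fun i => Derive (f i)) (fun t => cone_radius x y * cos t)).
  { eapply uniform_cv_ext; [| |apply (Ud (cone_radius x y) y)]; [|easy].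
    generalize Hpos. apply filter_imp. intros i Hi t Ht. destruct (Hi t Ht) as [Hf Hh].
    assert (E := conf_f x y (f i t) (h i t) Hk' Hl' Hf). fold (W i t) (S i t) in E.
    assert (HW : 0 < W i t) by apply exp_pos.
    transitivity (f i t * (Derive (f i) t / f i t)); [|field; lra].
    rewrite E at 1. unfold W', Z, conf_wp, conf_z. fold (W i t). field. repeat split; lra. }
  assert (UH' : uniform_cv K (fun i => Derive (h i)) (fun t => cone_radius y x * cos t)).
  { eapply uniform_cv_ext; [| |apply (Ud (cone_radius y x) (- x))]; [|easy].
    generalize Hpos. apply filter_imp. intros i Hi t Ht. destruct (Hi t Ht) as [Hf Hh].
    assert (E := conf_h x y (f i t) (h i t) Hk' Hl' Hh). fold (W i t) (S i t) in E.
    replace (- (x * S i t)) with (- x * S i t) in E by ring.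
    assert (HW : 0 < W i t) by apply exp_pos.
    transitivity (h i t * (Derive (h i) t / h i t)); [|field; lra].
    rewrite E at 1. unfold W', Z, conf_wp, conf_z. fold (W i t). field. repeat split; lra. }
  assert (Hsin0 : 0 < sin e) by (apply sin_gt_0; lra).
  assert (Hsin : forall A t, 0 < A -> K t -> A * sin e <= A * sin t).
  { intros A t HA Ht. apply Rmult_le_compat_l; [lra|].
    rewrite <- (Rmin_left (sin e) (sin e)) by lra. apply sin_ge_min; unfold K in Ht; lra. }
  assert (Uinv : forall (u : nat -> R -> R) A, 0 < A -> uniform_cv K u (fun t => A * sin t) ->
    uniform_cv K (fun i t => / u i t) (fun t => / (A * sin t)) /\
    bounded_on K (fun t => / (A * sin t))).
  { intros u A HA Hu. split.
    - apply (uniform_cv_inv K u _ (A * sin e)); [nra| |exact Hu].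
      intros t Ht. now apply Hsin.
    - exists (/ (A * sin e)). intros t Ht. assert (H := Hsin A t HA Ht).
      assert (0 < A * sin e) by nra.
      rewrite Rabs_right by (left; apply Rinv_0_lt_compat; lra).
      apply Rinv_le_contravar; lra. }
  assert (Hx : 0 < cone_radius x y) by lra. assert (Hy : 0 < cone_radius y x) by lra.
  intros c. destruct c; simpl.
  - split; [exact UF|]. now apply (bounded_on_mult K (fun _ => _)).
  - split; [exact UF'|]. now apply (bounded_on_mult K (fun _ => _)).
  - now apply Uinv.
  - split; [exact UH|]. now apply (bounded_on_mult K (fun _ => _)).
  - split; [exact UH'|]. now apply (bounded_on_mult K (fun _ => _)).
  - now apply Uinv.
Qed.

Theorem theorem4p1 (k l : nat) (hk : (2 <= k)%nat) (hl : (2 <= l)%nat)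
    (hkl : (k + l <= 8)%nat) (M : manifold)
    (g : nat -> profile) (hg : bohm_sequence k l M g)
    (K : R -> Prop) (hK : compact K) (hKin : forall t, K t -> 0 < t < PI) :
  eventually (fun i => forall t, K t -> 0 < t < prof_T (g i)) /\
  forall n : nat,
    norms_tend_to_0 (fun i =>
      sup_norm K (fun t => Derive_n (prof_f (g i)) n t - Derive_n (f_c k l) n t)) /\
    norms_tend_to_0 (fun i =>
      sup_norm K (fun t => Derive_n (prof_h (g i)) n t - Derive_n (h_c k l) n t)).
Proof.
  assert (HPI := PI_RGT_0).
  destruct (compact_in_open_interval K 0 PI HPI hK hKin) as [e [He HKe]].
  destruct (bohm_sequence_uniform k l M g e hk hl hg ltac:(lra)) as [HT HJ].
  assert (Hk' : 2 <= INR k) by (apply (le_INR 2 k hk)).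
  assert (Hl' : 2 <= INR l) by (apply (le_INR 2 l hl)).
  split.
  { generalize HT. apply filter_imp. intros i Hi t Ht. specialize (HKe t Ht). lra. }
  assert (Hcone := cone_warped_solution (INR k) (INR l) Hk' Hl').
  assert (Hmain : forall n c (u : profile -> R -> R) (v : R -> R),
    (forall p t, u p t = jet (prof_f p) (Derive (prof_f p)) (prof_h p) (Derive (prof_h p)) t c) ->
    (forall t, v t = jet (fun t => cone_radius (INR k) (INR l) * sin t)
       (fun t => cone_radius (INR k) (INR l) * cos t)
       (fun t => cone_radius (INR l) (INR k) * sin t)
       (fun t => cone_radius (INR l) (INR k) * cos t) t c) ->
    norms_tend_to_0 (fun i => sup_norm K (fun t => Derive_n (u (g i)) n t - Derive_n v n t))).
  { intros n c u v Hu Hv eps Heps.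
    destruct (uniform_cv_jet_eval _ _ _ (Nat.iter n (jet_deriv (INR k) (INR l)) (Jvar c))
      (fun c => proj1 (HJ c)) (fun c => proj2 (HJ c))) as [Hcv _].
    assert (He2 : 0 < eps / 2) by lra.
    generalize (filter_and _ _ HT (Hcv _ He2)). apply filter_imp.
    intros i [HTi Hi]. apply (sup_norm_lt K _ (eps / 2)); [lra|].
    intros t Ht. specialize (HKe t Ht).
    destruct (bohm_warped_solution k l M (g i) hk hl (bseq_metric _ _ _ _ hg i)) as [HS _].
    rewrite (Derive_n_jet _ _ _ _ _ _ _ (u (g i)) (Jvar c) n HS) by (try lra; intros; apply Hu).
    rewrite (Derive_n_jet _ _ _ _ _ _ _ v (Jvar c) n Hcone) by (try lra; intros; apply Hv).
    left. apply Hi. lra. }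
  intros n. split.
  - apply (Hmain n JF prof_f); [easy|]. intros t. reflexivity.
  - apply (Hmain n JH prof_h); [easy|]. intros t. unfold h_c, cone_radius. simpl.
    now rewrite (Rplus_comm (INR l) (INR k)).
Qed.
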